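(* Let $p>1$ and $a,b,L>0$. Then: (I) $\displaystyle \lambda^{a,b}_{1,p}(0,L)=\left(\frac{a+b}{2}\right)^p\lambda_{1,p}(0,L)$. (II) A function $u\in W^{1,p}_0(0,L)$ is an eigenfunction of $-\Delta^{a,b}_p$ associated to $\lambda^{a,b}_{1,p}(0,L)$ (i.e. a nontrivial weak solution of $-\Delta^{a,b}_p u=\lambda^{a,b}_{1,p}(0,L)|u|^{p-2}u$ in $(0,L)$, $u(0)=u(L)=0$) if and only if either $$u(t)=c\,\varphi^{a,b,+}_{p}\!\left(\tfrac{t}{L}\right)\quad\text{or}\quad u(t)=c\,\varphi^{a,b,-}_{p}\!\left(\tfrac{t}{L}\right)$$ for some constant $c>0$, where $\varphi^{a,b,\pm}_p$ are the functions defined in the context. In particular the set of eigenfunctions associated to $\lambda^{a,b}_{1,p}(0,L)$ is the union of two half-lines in $C^1[0,L]$, one generated by a function positive in $(0,L)$ and one generated by a function negative in $(0,L)$, and these two half-lines are collinear (i.e. $\varphi^{a,b,+}_p=-\varphi^{a,b,-}_p$) if and only if $a=b$.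
   Context: For $p>1$, $a,b,L>0$, the asymmetric $p$-Laplacian $\Delta^{a,b}_p u=\big(a^p[(u')^+]^{p-1}-b^p[(u')^-]^{p-1}\big)'$ is understood weakly: $u\in W^{1,p}_0(0,L)$ is a weak solution of $-\Delta^{a,b}_p u=g$ in $(0,L)$ if $\int_0^L\big(a^p[(u')^+]^{p-1}-b^p[(u')^-]^{p-1}\big)\varphi'\,dt=\int_0^L g\varphi\,dt$ for all $\varphi\in W^{1,p}_0(0,L)$. Here $s^\pm=\max\{\pm s,0\}$. $\lambda^{a,b}_{1,p}(0,L):=\inf\{\int_0^L a^p[(u')^+]^p+b^p[(u')^-]^p\,dt:\ u\in W^{1,p}_0(0,L),\ \|u\|_{L^p}=1\}$. $\pi_p:=2\int_0^1(1-t^p)^{-1/p}dt$ and $\lambda_{k,p}(0,L):=(p-1)\left(\frac{k\pi_p}{L}\right)^p$ for $k\in\mathbb N$; these are the Dirichlet eigenvalues of the classical operator $-\Delta_p u=-(|u'|^{p-2}u')'$ on $(0,L)$. $\varphi_p\in W^{1,p}_0(0,1)$ denotes the positive principal eigenfunction of $-\Delta_p$ on $(0,1)$ associated to $\lambda_{1,p}(0,1)$, normalized by $\|\varphi_p\|_{L^p}=1$. Let $t_0=\frac{a}{a+b}$. Define on $[0,1]$: $\varphi^{a,b,+}_p(t)=\varphi_p\!\left(\frac{t}{2t_0}\right)$ for $t\in[0,t_0)$, and $\varphi^{a,b,+}_p(t)=\varphi_p\!\left(\frac{t+1-2t_0}{2(1-t_0)}\right)$ for $t\in[t_0,1]$;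 $\varphi^{a,b,-}_p(t)=-\varphi_p\!\left(\frac{t}{2(1-t_0)}\right)$ for $t\in[0,1-t_0)$, and $\varphi^{a,b,-}_p(t)=-\varphi_p\!\left(\frac{t+2t_0-1}{2t_0}\right)$ for $t\in[1-t_0,1]$. *)

(* Defs.v *)
From HB Require Import structures.
From mathcomp Require Import all_boot all_order all_algebra.
From mathcomp Require Import all_classical all_reals all_analysis.
Set Implicit Arguments. Unset Strict Implicit. Unset Printing Implicit Defensive.
Import Order.TTheory GRing.Theory Num.Theory.
Import numFieldNormedType.Exports.
Local Open Scope classical_set_scope.
Local Open Scope ring_scope.

Section Defs.
Variable R : realType.
Local Notation mu := (@lebesgue_measure R).

Definition Iint (s t : R) (f : R -> R) : R := Rintegral mu `[s, t] f.

(* g is a (weak) derivative of u, witnessing u \in W^{1,p}_0(0,L):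
   g \in L^p(0,L) and u(t) = \int_0^t g for t in [0,L], with u(L) = 0.
   (1-D characterization of W^{1,p}_0(0,L) via absolutely continuous
   representatives; u is identified with its continuous representative.) *)
Definition wderiv (p L : R) (u g : R -> R) : Prop :=
  [/\ measurable_fun `[0, L] g,
      mu.-integrable `[0, L] (EFin \o g),
      (\int[mu]_(x in `[0%R, L]) (`|g x| `^ p)%:E < +oo)%E,
      Iint 0 L g = 0 &
      forall t, 0 <= t <= L -> u t = Iint 0 t g].

Definition W10 (p L : R) (u : R -> R) : Prop := exists g, wderiv p L u g.

Definition Lpp (p L : R) (u : R -> R) : R := Iint 0 L (fun t => `|u t| `^ p).

Definition pospart (s : R) : R := Num.max s 0.
Definition negpart (s : R) : R := Num.max (- s) 0.

Definition asym_flux (p a b s : R) : R :=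
  a `^ p * (pospart s) `^ (p - 1) - b `^ p * (negpart s) `^ (p - 1).

Definition plap_flux (p s : R) : R := `|s| `^ (p - 2) * s.

Definition lam_ab (p a b L : R) : R :=
  inf [set E | exists u g, wderiv p L u g /\ Lpp p L u = 1 /\
        E = Iint 0 L (fun t => a `^ p * (pospart (g t)) `^ p
                              + b `^ p * (negpart (g t)) `^ p)].

Definition pi_p (p : R) : R :=
  2 * fine (\int[mu]_(t in `[0, 1]) ((1 - t `^ p) `^ (- p^-1))%:E).

Definition lam_k (p : R) (k : nat) (L : R) : R :=
  (p - 1) * ((k%:R * pi_p p) / L) `^ p.

Definition weak_sol_ab (p a b L lam : R) (u : R -> R) : Prop :=
  exists g, wderiv p L u g /\
    forall phi h, wderiv p L phi h ->
      Iint 0 L (fun t => asym_flux p a b (g t) * h t)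
      = lam * Iint 0 L (fun t => plap_flux p (u t) * phi t).

Definition weak_sol_p (p L lam : R) (u : R -> R) : Prop :=
  exists g, wderiv p L u g /\
    forall phi h, wderiv p L phi h ->
      Iint 0 L (fun t => plap_flux p (g t) * h t)
      = lam * Iint 0 L (fun t => plap_flux p (u t) * phi t).

Definition eigenfn_ab (p a b L : R) (u : R -> R) : Prop :=
  W10 p L u /\ (exists t, 0 <= t <= L /\ u t != 0) /\
  weak_sol_ab p a b L (lam_ab p a b L) u.

Definition is_phi_p (p : R) (f : R -> R) : Prop :=
  [/\ W10 p 1 f, (forall t, 0 < t < 1 -> 0 < f t), Lpp p 1 f = 1 &
      weak_sol_p p 1 (lam_k p 1 1) f].

Definition phi_p (p : R) : R -> R := get [set f | is_phi_p p f].

Definition t0 (a b : R) : R := a / (a + b).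

Definition phi_plus (p a b : R) (t : R) : R :=
  if t < t0 a b then phi_p p (t / (2 * t0 a b))
  else phi_p p ((t + 1 - 2 * t0 a b) / (2 * (1 - t0 a b))).

Definition phi_minus (p a b : R) (t : R) : R :=
  if t < 1 - t0 a b then - phi_p p (t / (2 * (1 - t0 a b)))
  else - phi_p p ((t + 2 * t0 a b - 1) / (2 * t0 a b)).

Definition C1_01 (f : R -> R) : Prop :=
  exists df : R -> R,
    {within `[0, 1], continuous df} /\
    forall x, 0 <= x <= 1 ->
      (fun y => (f y - f x) / (y - x)) @
        within (fun y => 0 <= y <= 1 /\ y != x) (nbhs x) --> df x.

End Defs.

(* Main.v *)
Require Import Defs.
From HB Require Import structures.
From mathcomp Require Import all_boot all_order all_algebra.
From mathcomp Require Import all_classical all_reals all_analysis.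
From mathcomp Require Import measurable_realfun ring lra.
Set Implicit Arguments. Unset Strict Implicit. Unset Printing Implicit Defensive.
Import Order.TTheory GRing.Theory Num.Theory.
Import numFieldNormedType.Exports.
Local Open Scope classical_set_scope.
Local Open Scope ring_scope.

(** A function [u] in [W^{1,p}_0] with [max |u| = 1 = u(m)] is compared with the
first-order flow [u' = (k/a) (1 - u^p)^(1/p)] on [[0, m]] and
[u' = - (k/b) (1 - u^p)^(1/p)] on [[m, L]], where [k = (a + b) pi_p / (2 L)].
Young's inequality on each side bounds the energy density from below by
[p a k^(p-1) u' (1 - |u|^p)^(1-1/p) - (p-1) k^p (1 - |u|^p)], resp. by the same
expression with [- b] in place of [a].  The first terms integrate to constants by
the chain rule, and the value of [k] is the one for which all constants cancel:
what remains is [energy >= (p-1) k^p * int |u|^p].  Equality forces the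
first-order flow almost everywhere; as [(1 - u^p)^(1/p)] decreases in [u >= 0],
its solution from each end of the interval is unique, namely a rescaled
generalised sine, and the two halves only fit together when [m] is
[a L / (a + b)].  A weak solution tested against itself is such an equality case,
which yields rigidity for eigenfunctions and also identifies [phi_p]. *)

(** * Integration over closed intervals, uniform continuity and telescoping *)

Section IntervalIntegral.
Variable R : realType.
Local Notation mu := (@lebesgue_measure R).
Implicit Types (s t x y c e : R) (f g h k u v : R -> R).

(** The constant [k] comes from an integration by parts for the generalised sine,
    [p * fluxint = (p - 1) * halfpi]: the chain-rule terms of the two sides of the maximum
    contribute [p * (a + b) * k^(p-1) * fluxint], which has to balance [(p - 1) * k^p * L].
    Existence of minimisers never enters: the explicit profile is a weak solution, and testing it
    against itself shows that the lower bound is attained. Only one sign needs work, because a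
    change of sign exchanges [a] and [b]; this serves both for the falling side of a function and
    for functions whose extremum is negative. Two obstacles shape the analysis. A function of
    W^{1,p}_0 is known only through the integrals of its derivative, so the product and chain rules
    are obtained by summing increments, without pointwise differentiability. And the right-hand side
    of the flow is not Lipschitz at 1, where uniqueness really fails, since a falling solution can
    leave the constant 1 at any moment; this is why both halves are followed from the zeros and not
    from the maximum. *)

Definition itg s t f := mu.-integrable `[s, t] (EFin \o f).

Lemma itgS s t x y f : s <= x -> y <= t -> itg s t f -> itg x y f.
Proof.
move=> sx yt; apply: integrableS => //.
by apply: subset_itv; rewrite bnd_simp.
Qed.

Lemma eq_itg s t f g :
  (forall x, s <= x <= t -> f x = g x) -> itg s t f -> itg s t g.
Proof.
move=> fg; apply: eq_integrable => // x; rewrite inE/= in_itv/= => xst.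
by rewrite /= fg.
Qed.

Lemma continuous_itg s t f : continuous f -> itg s t f.
Proof.
move=> cf; apply: continuous_compact_integrable; first exact: segment_compact.
exact: continuous_subspaceT.
Qed.

Lemma itg_measurable s t f : itg s t f -> measurable_fun `[s, t] f.
Proof. by move=> /integrableP[/measurable_EFinP]. Qed.

Lemma itgD s t f g : itg s t f -> itg s t g -> itg s t (fun x => f x + g x).
Proof.
move=> fi gi; rewrite /itg.
rewrite (_ : _ \o _ = (EFin \o f) \+ (EFin \o g))%E//; exact: integrableD.
Qed.

Lemma itgZ s t c f : itg s t f -> itg s t (fun x => c * f x).
Proof.
move=> fi; rewrite /itg.
rewrite (_ : _ \o _ = fun x => c%:E * (EFin \o f) x)%E//; exact: integrableZl.
Qed.

Lemma itgB s t f g : itg s t f -> itg s t g -> itg s t (fun x => f x - g x).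
Proof.
move=> fi gi; rewrite /itg.
rewrite (_ : _ \o _ = (EFin \o f) \- (EFin \o g))%E//; exact: integrableB.
Qed.

Lemma itg_norm s t f : itg s t f -> itg s t (fun x => `|f x|).
Proof. by move=> fi; exact: integrable_norm. Qed.

Lemma le_itg s t f g : measurable_fun `[s, t] f ->
  (forall x, s <= x <= t -> `|f x| <= g x) -> itg s t g -> itg s t f.
Proof.
move=> mf fg; apply: le_integrable => //; first exact/measurable_EFinP.
move=> x /=; rewrite in_itv/= lee_fin => /fg /le_trans; apply.
exact: ler_norm.
Qed.

Lemma continuous_bounded s t k : continuous k ->
  exists2 M, 0 <= M & forall x, s <= x <= t -> `|k x| <= M.
Proof.
move=> ck; case: (leP s t) => [st|ts]; last first.
  exists 0 => // x /andP[sx xt]; have := le_lt_trans (le_trans sx xt) ts.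
  by rewrite ltxx.
have [|c _ H] := @EVT_max R (fun x => `|k x|) s t st.
  apply: continuous_subspaceT => x; apply: continuous_comp; first exact: ck.
  exact: norm_continuous.
by exists `|k c| => // x xst; apply: H; rewrite in_itv.
Qed.

Lemma itgM s t k g : continuous k -> itg s t g -> itg s t (fun x => k x * g x).
Proof.
move=> ck gi; have [M M0 kM] := continuous_bounded s t ck.
apply: (@le_itg _ _ _ (fun x => M * `|g x|)); last exact/itgZ/itg_norm.
  apply: measurable_funM; last exact: itg_measurable.
  exact: itg_measurable (continuous_itg _ _ ck).
by move=> x xst; rewrite normrM ler_wpM2r// kM.
Qed.

Lemma eq_Iint s t f g :
  (forall x, s <= x <= t -> f x = g x) -> Iint s t f = Iint s t g.
Proof.
move=> fg; apply: eq_Rintegral => x; rewrite inE/= in_itv/=; exact: fg.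
Qed.

Lemma Iintxx x f : Iint x x f = 0.
Proof. by rewrite /Iint set_itv1 Rintegral_set1. Qed.

Lemma Iint_split s x t f : s <= x <= t -> itg s t f ->
  Iint s t f = Iint s x f + Iint x t f.
Proof.
move=> /andP[sx xt] fi; rewrite /Iint.
have := @Rintegral_itvB R f (BLeft s) (BRight t) x fi.
rewrite !bnd_simp => /(_ sx xt); rewrite Rintegral_itv_obnd_cbnd; first lra.
by apply: integrableS fi => //; apply: subset_itv; rewrite bnd_simp.
Qed.

Lemma IintD s t f g : itg s t f -> itg s t g ->
  Iint s t (fun x => f x + g x) = Iint s t f + Iint s t g.
Proof. by move=> fi gi; rewrite /Iint RintegralD. Qed.

Lemma IintB s t f g : itg s t f -> itg s t g ->
  Iint s t (fun x => f x - g x) = Iint s t f - Iint s t g.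
Proof. by move=> fi gi; rewrite /Iint RintegralB. Qed.

Lemma IintZ s t c f : itg s t f -> Iint s t (fun x => c * f x) = c * Iint s t f.
Proof. by move=> fi; rewrite /Iint RintegralZl. Qed.

Lemma Iint_cst s t c : s <= t -> Iint s t (fun=> c) = c * (t - s).
Proof.
move=> st; rewrite /Iint (Rintegral_cst _ _ c)//.
have E : mu `[s, t] = (t - s)%:E.
  rewrite lebesgue_measure_itv/= lte_fin.
  by case: ltgtP st => //= -> _; rewrite subrr.
exact: (congr1 (fun z => c * fine z) E).
Qed.

Lemma Iint_ge0 s t f : (forall x, s <= x <= t -> 0 <= f x) -> 0 <= Iint s t f.
Proof. by move=> f0; apply: Rintegral_ge0 => x /=; rewrite in_itv/=; exact: f0. Qed.

Lemma le_Iint s t f g : itg s t f -> itg s t g ->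
  (forall x, s <= x <= t -> f x <= g x) -> Iint s t f <= Iint s t g.
Proof.
by move=> fi gi fg; apply: le_Rintegral => // x /=; rewrite in_itv/=; exact: fg.
Qed.

Lemma ler_norm_Iint s t f : itg s t f -> `|Iint s t f| <= Iint s t (fun x => `|f x|).
Proof. by move=> fi; exact: le_normr_Rintegral. Qed.

(** The local error estimate behind the product rule, the chain rule and the difference quotients: a
    continuous factor is replaced by a constant on a short interval. *)
Lemma Iint_freeze s t c e k g : continuous k -> itg s t g ->
  (forall x, s <= x <= t -> `|k x - c| <= e) ->
  `|Iint s t (fun x => k x * g x) - c * Iint s t g|
    <= e * Iint s t (fun x => `|g x|).
Proof.
move=> ck gi ke; rewrite -IintZ// -IintB; [|exact: itgM|exact: itgZ].
rewrite -IintZ; last exact: itg_norm.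
have i1 : itg s t (fun x => k x * g x - c * g x).
  by apply: itgB; [exact: itgM|exact: itgZ].
apply: le_trans (ler_norm_Iint i1) _; apply: le_Iint.
- exact: itg_norm.
- exact/itgZ/itg_norm.
- by move=> x xst; rewrite -mulrBl normrM ler_wpM2r// ke.
Qed.

Lemma Iint_ae0 s t f : itg s t f -> (forall x, s <= x <= t -> 0 <= f x) ->
  Iint s t f = 0 -> ae_eq mu `[s, t]%classic f (cst 0).
Proof.
move=> fi f0 If0.
have If : (\int[mu]_(x in `[s, t]) `|(EFin \o f) x| = 0)%E.
  rewrite (_ : (\int[mu]_(x in `[s, t]) _)%E =
      (\int[mu]_(x in `[s, t]) (f x)%:E)%E); last first.
    apply: eq_integral => x; rewrite inE/= in_itv/= => xst.
    by rewrite ger0_norm// f0.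
  rewrite -[LHS]fineK; last exact: integrable_fin_num.
  by congr EFin; exact: If0.
have mf : measurable_fun `[s, t] (EFin \o f) by case/integrableP: fi.
have mst : measurable (`[s, t] : set R) by [].
have H := (ae_eq_integral_abs mu mst mf).1 If.
have : ae_eq mu `[s, t]%classic (fine \o (EFin \o f)) (fine \o cst 0%E).
  exact: ae_eq_comp.
by [].
Qed.

Lemma ae_eq_Iint s t f g : itg s t f -> itg s t g -> ae_eq mu `[s, t]%classic f g ->
  Iint s t f = Iint s t g.
Proof.
move=> fi gi fg; rewrite /Iint /Rintegral; congr fine.
apply: ae_eq_integral => //.
- by case/integrableP: fi.
- by case/integrableP: gi.
- exact: (@ae_eq_comp _ _ _ mu `[s, t]%classic R (\bar R) EFin).
Qed.

Lemma Iint_abs_cont s t g e : itg s t g -> 0 < e ->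
  exists2 d, 0 < d & forall x y, s <= x -> y <= t -> x <= y -> y - x < d ->
    Iint x y (fun z => `|g z|) <= e.
Proof.
move=> gi e0.
have gT : mu.-integrable setT (EFin \o g \_ `[s, t]).
  by rewrite -restrict_EFin; apply/integrable_restrict => //=; rewrite setTI.
have [d [d0 H]] := integral_normr_continuous gT e0.
exists d => // x y sx yt xy yxd; apply: ltW.
have -> : Iint x y (fun z => `|g z|) = Iint x y (fun z => `|(g \_ `[s, t]) z|).
  apply: eq_Iint => z /andP[xz zy]; rewrite patchE mem_set//= in_itv/=.
  by rewrite (le_trans sx xz) (le_trans zy yt).
rewrite /Iint; apply: (H `[x, y]%classic) => //.
suff : (mu `[x, y] < d%:E)%E by [].
rewrite lebesgue_measure_itv/= lte_fin; case: ifP => // _.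
Qed.

Lemma heine_cantor s t f e : continuous f -> 0 < e ->
  exists2 d, 0 < d & forall x y, s <= x <= t -> `|y - x| < d -> `|f y - f x| <= e.
Proof.
move=> cf e0.
(* Compactness is used along the filter of radii tending to [0] from the right, so that the local
   radii merge into a single [d]. *)
have /compact_near_coveringP/(_ R 0^'+ (fun d x =>
   forall y, `|y - x| < d -> `|f y - f x| <= e)) := @segment_compact R s t.
case=> [x _|d /= d0 H].
  have /cvgrPdist_le/(_ (e / 2)) := cf x; rewrite divr_gt0// => /(_ isT).
  move=> /nbhs_ballP[/= d d0 H].
  exists (ball x (d / 2), [set d' | 0 < d' < d / 2]) => /=.
    split; first by apply: nbhsx_ballx; rewrite divr_gt0.
    have := @nbhs_right_lt R 0 (d / 2); rewrite divr_gt0// => /(_ isT) A.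
    have B := @nbhs_right_gt R 0; near=> z.
    by apply/andP; split; near: z.
  move=> [z d'] [/=]; rewrite /ball/= => xz /andP[d'0 d'd] y yz.
  have Hz : `|f x - f z| <= e / 2.
    by apply: H; rewrite /ball/= (lt_trans xz)// ltr_pdivrMr// ltr_pMr// ltr1n.
  have Hy : `|f x - f y| <= e / 2.
    apply: H; rewrite /ball/=.
    rewrite (_ : x - y = (x - z) - (y - z)); last by ring.
    rewrite (le_lt_trans (ler_normB _ _))//; lra.
  rewrite (_ : f y - f z = (f x - f z) - (f x - f y)); last by ring.
  rewrite (le_trans (ler_normB _ _))//; lra.
have d2 : 0 < d / 2 by rewrite divr_gt0.
exists (d / 2) => // x y xst xy; apply: (H (d / 2)) => //.
- by rewrite /ball/= sub0r normrN gtr0_norm// ltr_pdivrMr// ltr_pMr// ltr1n.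
Unshelve. all: by end_near. Qed.

(* Telescoping along a partition of mesh [< d]. *)
Lemma small_increments s t (Psi N : R -> R) : s <= t ->
  (forall e, 0 < e -> exists2 d, 0 < d & forall x y, s <= x -> y <= t ->
     x <= y -> y - x < d -> `|Psi y - Psi x| <= e * (N y - N x)) ->
  Psi t = Psi s.
Proof.
move=> st H.
have {}H e : 0 < e -> `|Psi t - Psi s| <= e * (N t - N s).
  move=> e0; have [d dp {}H] := H e e0.
  (* Steps of length [d / 2] respect the strict bound [< d] on the mesh; the induction is on their
     number. *)
  suff G : forall n x, s <= x -> x <= t -> x - s <= n%:R * (d / 2) ->
      `|Psi x - Psi s| <= e * (N x - N s).
    apply: (G (Num.bound ((t - s) / (d / 2)))) => //.
    rewrite -ler_pdivrMr ?divr_gt0//.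
    rewrite ltW//; apply: archi_boundP; apply: divr_ge0; lra.
  elim=> [x sx xt xs|n IH x sx xt xs].
    have -> : x = s by apply/eqP; rewrite eq_le sx andbT; lra.
    by rewrite !subrr normr0 mulr0.
  case: (leP (x - d / 2) s) => [xd|xd]; first by apply: H => //; lra.
  have y1 : x - d / 2 - s <= n%:R * (d / 2) by rewrite -natr1 in xs; lra.
  have A := IH (x - d / 2) (ltW xd) ltac:(lra) y1.
  have B := H (x - d / 2) x (ltW xd) xt ltac:(lra) ltac:(lra).
  rewrite (_ : Psi x - Psi s =
    (Psi x - Psi (x - d / 2)) + (Psi (x - d / 2) - Psi s)); last by ring.
  rewrite (le_trans (ler_normD _ _))//; lra.
apply/eqP; rewrite -subr_eq0 -normr_eq0 eq_le normr_ge0 andbT.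
apply/ler_addgt0Pl => e e0; rewrite addr0.
(* If [N] does not grow, the bound with [e = 1] already suffices; otherwise [e] is divided by the
   growth of [N]. *)
have [N0|N0] := ltP 0 (N t - N s); last first.
  by have := H 1 ltr01; rewrite mul1r => /le_trans; apply; exact: le_trans (ltW e0).
by have := H _ (divr_gt0 e0 N0); rewrite divfK// gt_eqF.
Qed.

End IntervalIntegral.

(** * Absolutely continuous functions: product rule, chain rule, primitives *)

Section AbsolutelyContinuous.
Variable R : realType.
Local Notation mu := (@lebesgue_measure R).
Implicit Types (s t x y c e : R) (f g h k u v : R -> R).

(** Continuity is asked on the whole line, not just on [s, t], so that compositions need no subspace
    topology. *)
Definition acf s t u g := [/\ continuous u, itg s t g &
  forall x y, s <= x -> x <= y -> y <= t -> u y - u x = Iint x y g].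

Lemma Iint_diff s t x y f : s <= x -> x <= y -> y <= t -> itg s t f ->
  Iint s y f - Iint s x f = Iint x y f.
Proof.
move=> sx xy yt fi; rewrite (@Iint_split _ s x y) ?sx ?xy//; first by rewrite addrC addKr.
exact: itgS fi.
Qed.

Lemma acfS s t x y u g : s <= x -> y <= t -> acf s t u g -> acf x y u g.
Proof.
move=> sx yt [cu gi ug]; split => //; first exact: itgS gi.
by move=> a b xa ab bY; apply: ug => //; [exact: le_trans xa|exact: le_trans yt].
Qed.

Lemma acfZ s t c u g : acf s t u g -> acf s t (fun x => c * u x) (fun x => c * g x).
Proof.
move=> [cu gi ug]; split.
- by move=> x; apply: continuousM; [exact: cst_continuous|exact: cu].
- exact: itgZ.
- move=> x y sx xy yt; rewrite IintZ; last exact: itgS gi.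
  by rewrite -ug// mulrBr.
Qed.

Lemma acfB s t u g v h : acf s t u g -> acf s t v h ->
  acf s t (fun x => u x - v x) (fun x => g x - h x).
Proof.
move=> [cu gi ug] [cv hi vh]; split.
- by move=> x; apply: continuousB; [exact: cu|exact: cv].
- exact: itgB.
- move=> x y sx xy yt; rewrite IintB; [|exact: itgS gi|exact: itgS hi].
  by rewrite -ug// -vh//; ring.
Qed.

(** The increment of [u * v] over [x, y] is exactly [u x] times that of [v] plus [v y] times that of
    [u]. Freezing [u] at the left end and [v] at the right end therefore leaves only two freezing
    errors. *)
Lemma acf_prod s t u g v h : s <= t -> acf s t u g -> acf s t v h ->
  Iint s t (fun x => u x * h x + v x * g x) = u t * v t - u s * v s.
Proof.
move=> st [cu gi ug] [cv hi vh].
have uhi : itg s t (fun x => u x * h x) by exact: itgM.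
have vgi : itg s t (fun x => v x * g x) by exact: itgM.
have wi := itgD uhi vgi.
have ni : itg s t (fun x => `|h x| + `|g x|) by apply: itgD; exact: itg_norm.
pose Psi z := u z * v z - Iint s z (fun x => u x * h x + v x * g x).
suff : Psi t = Psi s by rewrite /Psi Iintxx; lra.
apply: (@small_increments R s t Psi (fun z => Iint s z (fun x => `|h x| + `|g x|))) => //.
move=> e e0.
have [d1 d10 H1] := @heine_cantor R s t u e cu e0.
have [d2 d20 H2] := @heine_cantor R s t v e cv e0.
exists (Num.min d1 d2); first by rewrite lt_min d10.
move=> x y sx yt xy; rewrite lt_min => /andP[yx1 yx2].
rewrite (Iint_diff sx xy yt ni) {}/Psi.
have -> : u y * v y - Iint s y (fun x => u x * h x + v x * g x) -
    (u x * v x - Iint s x (fun x => u x * h x + v x * g x)) =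
  - (Iint x y (fun x => u x * h x) - u x * Iint x y h)
  - (Iint x y (fun x => v x * g x) - v y * Iint x y g).
  rewrite -ug// -vh//.
  have := Iint_diff sx xy yt wi; rewrite [RHS]IintD; [|exact: itgS uhi|exact: itgS vgi].
  lra.
have A : `|Iint x y (fun x => u x * h x) - u x * Iint x y h|
    <= e * Iint x y (fun z => `|h z|).
  apply: Iint_freeze => //; first exact: itgS hi.
  move=> w /andP[xw wy]; apply: H1; first by rewrite sx (le_trans xy).
  rewrite ger0_norm ?subr_ge0//; lra.
have B : `|Iint x y (fun x => v x * g x) - v y * Iint x y g|
    <= e * Iint x y (fun z => `|g z|).
  apply: Iint_freeze => //; first exact: itgS gi.
  move=> w /andP[xw wy]; apply: H2; first by rewrite yt (le_trans sx).
  rewrite ler0_norm; lra.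
rewrite IintD; [|exact/itg_norm/(itgS sx yt)|exact/itg_norm/(itgS sx yt)].
rewrite (le_trans (ler_normB _ _))// normrN mulrDr lerD//.
Qed.

(** Over a short [x, y] both the integral and the increment of [K] along [u] are close to
    [k (u x) * (u y - u x)]: the former because [k (u z)] is nearly constant in [z], the latter
    because [k] is nearly constant between [u x] and [u y]. The two errors account for the factor 2
    in the telescoping weight. *)
Lemma acf_comp s t u g k (K : R -> R) lo hi : s <= t -> acf s t u g ->
  continuous k ->
  (forall x y, lo <= x -> x <= y -> y <= hi -> K y - K x = Iint x y k) ->
  (forall x, s <= x <= t -> lo <= u x <= hi) ->
  Iint s t (fun x => k (u x) * g x) = K (u t) - K (u s).
Proof.
move=> st [cu gi ug] ck Kk ulh.
have cku : continuous (fun x => k (u x)).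
  by move=> x; apply: continuous_comp; [exact: cu|exact: ck].
have ki : itg s t (fun x => k (u x) * g x) by exact: (itgM cku).
have ni := itg_norm gi.
pose Psi z := K (u z) - Iint s z (fun x => k (u x) * g x).
suff : Psi t = Psi s by rewrite /Psi Iintxx; lra.
apply: (@small_increments R s t Psi (fun z => 2 * Iint s z (fun x => `|g x|))) => //.
move=> e e0.
have [d1 d10 H1] := @heine_cantor R lo hi k e ck e0.
have [d2 d20 H2] := @Iint_abs_cont R s t g (d1 / 2) gi (divr_gt0 d10 (ltr0Sn _ _)).
exists d2 => // x y sx yt xy yx.
have xst : s <= x <= t by rewrite sx (le_trans xy).
have yst : s <= y <= t by rewrite yt (le_trans sx).
rewrite -mulrBr (Iint_diff sx xy yt ni) {}/Psi.
have du w : x <= w -> w <= y -> `|u w - u x| <= Iint x w (fun z => `|g z|).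
  move=> xw wy; rewrite ug//; last exact: le_trans yt.
  by apply: ler_norm_Iint; apply: itgS gi => //; exact: le_trans yt.
have du1 w : x <= w -> w <= y -> `|u w - u x| < d1.
  move=> xw wy; apply: le_lt_trans (du _ xw wy) _.
  apply: le_lt_trans (H2 _ _ sx _ xw _) _; [exact: le_trans yt|lra|lra].
have B : `|Iint x y (fun x => k (u x) * g x) - k (u x) * Iint x y g|
    <= e * Iint x y (fun z => `|g z|).
  apply: (Iint_freeze cku); first exact: itgS gi.
  by move=> w /andP[xw wy]; apply: H1; [exact: ulh|exact: du1].
(* Stated for ordered values, because [u] may rise or fall from [x] to [y]; both cases below reduce
   to it. *)
have fr a b : lo <= a -> a <= b -> b <= hi ->
    (forall w, a <= w <= b -> `|w - u x| < d1) ->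
    `|(K b - K a) - k (u x) * (b - a)| <= e * (b - a).
  move=> la ab bh abd; have := @Iint_freeze R a b (k (u x)) e k (fun=> 1) ck.
  rewrite normr1 !Iint_cst// !mul1r => /(_ _ _).
  rewrite (_ : Iint a b (fun z => k z * 1) = K b - K a); last first.
    by rewrite Kk//; apply: eq_Iint => z _; rewrite mulr1.
  apply; first exact/continuous_itg/cst_continuous.
  by move=> w wab; apply: H1; [exact: ulh|exact: abd].
have A : `|(K (u y) - K (u x)) - k (u x) * (u y - u x)|
    <= e * Iint x y (fun z => `|g z|).
  apply: (@le_trans _ _ (e * `|u y - u x|)); last by rewrite ler_pM2l// du.
  have := du1 y xy (lexx y) => dy.
  case: (leP (u x) (u y)) => uxy.
    rewrite (ger0_norm (_ : 0 <= u y - u x)) ?subr_ge0//.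
    apply: fr => //; [by case/andP: (ulh _ xst)|by case/andP: (ulh _ yst)|].
    move=> w /andP[w1 w2]; move: dy.
    by rewrite !ger0_norm ?subr_ge0//; lra.
  rewrite (ltr0_norm (_ : u y - u x < 0)) ?subr_lt0//.
  rewrite -normrN (_ : - (_ - _) = (K (u x) - K (u y)) - k (u x) * (u x - u y)); last by ring.
  rewrite opprB; apply: fr => //; [by case/andP: (ulh _ yst)|exact: ltW|by case/andP: (ulh _ xst)|].
  move=> w /andP[w1 w2]; move: dy.
  by rewrite ltr0_norm ?subr_lt0// ler0_norm ?subr_le0//; lra.
have -> : K (u y) - Iint s y (fun x => k (u x) * g x) -
    (K (u x) - Iint s x (fun x => k (u x) * g x)) =
  ((K (u y) - K (u x)) - k (u x) * (u y - u x))
  - (Iint x y (fun x => k (u x) * g x) - k (u x) * Iint x y g).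
  by rewrite -ug//; have := Iint_diff sx xy yt ki; lra.
rewrite (le_trans (ler_normB _ _))//; lra.
Qed.

(** Projection onto [s, t], used to extend functions continuously by constants beyond the
    interval. *)
Definition clamp s t x : R := Num.min t (Num.max s x).

Lemma clamp_id s t x : s <= x <= t -> clamp s t x = x.
Proof. by move=> /andP[sx xt]; rewrite /clamp max_r// min_r. Qed.

Lemma clamp_itv s t x : s <= t -> s <= clamp s t x <= t.
Proof. by move=> st; rewrite /clamp ge_min lexx le_min st le_max lexx. Qed.

Lemma clamp_lip s t x y : x <= y -> 0 <= clamp s t y - clamp s t x <= y - x.
Proof.
rewrite /clamp /Num.min /Num.max => xy.
by case: (ltP s x) => ?; case: (ltP s y) => ?; case: ltP => ?; case: ltP => ?; lra.
Qed.

Lemma acf_primitive s t g : s <= t -> itg s t g ->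
  acf s t (fun x => Iint s (clamp s t x) g) g.
Proof.
move=> st gi; split => //; last first.
  move=> x y sx xy yt; rewrite !clamp_id ?sx ?yt ?(le_trans sx)//.
    exact: (Iint_diff sx xy yt).
  by rewrite (le_trans xy).
have incr e : 0 < e -> exists2 d, 0 < d & forall x y, x <= y -> y - x < d ->
    `|Iint s (clamp s t y) g - Iint s (clamp s t x) g| <= e.
  move=> e0; have [d d0 H] := @Iint_abs_cont R s t g e gi e0.
  exists d => // x y xy yx; have /andP[c1 c2] := clamp_lip s t xy.
  have /andP[a1 a2] := clamp_itv x st; have /andP[b1 b2] := clamp_itv y st.
  rewrite subr_ge0 in c1; rewrite (Iint_diff a1 c1 b2 gi).
  rewrite (le_trans (ler_norm_Iint _))//; first exact: itgS gi.
  by apply: H => //; lra.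
move=> x; apply/cvgrPdist_le => e e0; have [d d0 H] := incr e e0.
near=> y.
have xyd : `|x - y| < d by near: y; exact: cvgr_dist_lt.
case: (leP x y) => xy.
  by rewrite distrC; apply: H => //; move: xyd; rewrite ler0_norm; lra.
by apply: H; [exact: ltW|move: xyd; rewrite gtr0_norm; lra].
Unshelve. all: by end_near. Qed.

Lemma acf_derive s t u g x : continuous g -> acf s t u g -> s < x < t ->
  is_derive x 1 u (g x).
Proof.
move=> cg [cu gi ug] /andP[sx xt].
have [D E] := @continuous_FTC1_closed R g s x t xt gi sx (cg x).
have : is_derive x 1 (fun y => u s + Iint s y g) (0 + g x).
  apply: is_deriveD; apply: DeriveDef; first exact: D.
  by rewrite -derive1E; exact: E.
rewrite add0r; apply: near_eq_is_derive.
near=> y.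
have sy : s <= y by apply: ltW; near: y; exact: lt_nbhsr.
have yt : y <= t by apply: ltW; near: y; exact: lt_nbhsl.
by rewrite -(ug s y)// addrC subrK.
Unshelve. all: by end_near. Qed.

(** Derivatives are asked only in the open interval: the generalised sine and cosine vanish at the
    ends, where their powers have no usable derivative formula. *)
Lemma derive_acf s t u g : continuous u -> continuous g ->
  (forall x, s < x < t -> is_derive x 1 u (g x)) -> acf s t u g.
Proof.
move=> cu cg H; split => //; first exact: continuous_itg.
move=> x y sx; rewrite le_eqVlt => /predU1P[->|xy] yt.
  by rewrite Iintxx subrr.
have D z : z \in `]x, y[ -> is_derive z 1 u (g z).
  rewrite in_itv/= => /andP[xz zy]; apply: H.
  by rewrite (le_lt_trans sx)//= (lt_le_trans zy).
rewrite /Iint /Rintegral (@continuous_FTC2 R g u x y xy)//.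
- exact: continuous_subspaceT.
- split; [by move=> z /D dz; exact: ex_derive| |].
  + by apply: cvg_at_right_filter; exact: cu.
  + by apply: cvg_at_left_filter; exact: cu.
- by move=> z /D dz; rewrite derive1E; exact: derive_val.
Qed.

End AbsolutelyContinuous.

(** * Real powers and Young's inequality with its equality case *)

Section PowerFunctions.
Variable R : realType.
Implicit Types (x y z q s t e c : R).

Lemma le_powR x y q : 0 <= q -> 0 <= x -> x <= y -> x `^ q <= y `^ q.
Proof.
move=> q0 x0 xy; apply: ge0_ler_powR => //; rewrite nnegrE//.
exact: le_trans xy.
Qed.

Lemma lt_powR x y q : 0 < q -> 0 <= x -> x < y -> x `^ q < y `^ q.
Proof.
move=> q0 x0 xy; apply: gt0_ltr_powR => //; rewrite nnegrE//.
exact: le_trans (ltW xy).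
Qed.

Lemma one_powR q : 1 `^ q = 1 :> R. Proof. by rewrite powR1. Qed.

Lemma powRVK x q : 0 <= x -> q != 0 -> (x `^ q^-1) `^ q = x.
Proof. by move=> x0 q0; rewrite -powRrM mulVf// powRr1. Qed.

Lemma norm_powR_continuous q : 0 < q -> continuous (fun x => `|x| `^ q).
Proof.
move=> q0 x; have [->|x0] := eqVneq x 0.
  apply/cvgrPdist_le => e e0.
  rewrite normr0 powR0 ?gt_eqF//; near=> y.
  rewrite sub0r normrN ger0_norm ?powR_ge0//.
  rewrite -[leRHS](powRVK (ltW e0) (lt0r_neq0 q0)).
  apply: le_powR => //; first exact: ltW.
  apply: ltW; rewrite -[in ltLHS](subr0 y) distrC.
  by near: y; apply: cvgr_dist_lt => //; exact: powR_gt0.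
apply: (@continuous_comp _ _ _ (fun x : R => `|x|) (fun x => x `^ q)).
  exact: norm_continuous.
apply: differentiable_continuous; apply/derivable1_diffP.
by apply: derivable_powR; rewrite in_itv/= andbT normr_gt0.
Unshelve. all: by end_near. Qed.

Lemma max0_continuous (f : R -> R) :
  continuous f -> continuous (fun x => Num.max 0 (f x)).
Proof. by move=> cf x; apply: (@continuous_max _ _ (cst 0) f); [exact: cst_continuous|exact: cf]. Qed.

Lemma cstB_continuous c (f : R -> R) :
  continuous f -> continuous (fun x => c - f x).
Proof. by move=> cf x; apply: cvgB; [exact: cvg_cst|exact: cf]. Qed.

Lemma powR_comp_continuous q (f : R -> R) : 0 < q ->
  continuous f -> (forall x, 0 <= f x) -> continuous (fun x => f x `^ q).
Proof.
move=> q0 cf f0.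
rewrite (_ : (fun x => _) = (fun y => `|y| `^ q) \o f); last first.
  by apply/funext => x /=; rewrite ger0_norm.
by move=> x; apply: continuous_comp; [exact: cf|exact: norm_powR_continuous].
Qed.

Lemma is_derive_powR_comp q (f : R -> R) x c : 0 < f x -> is_derive x 1 f c ->
  is_derive x 1 (fun s => f s `^ q) (q * f x `^ (q - 1) * c).
Proof.
move=> f0 df; exact: (@is_derive1_comp R (fun y => y `^ q) f x _ c (is_derive1_powR q f0) df).
Qed.

Lemma is_derive_cmul c (f : R -> R) x e : is_derive x 1 f e ->
  is_derive x 1 (fun s => c * f s) (c * e).
Proof. by move=> df; exact: (@is_deriveZ R R R f c x 1 e df). Qed.

(* After division by [z `^ p] this is a convex combination of the tangent
   inequality [1 + x <= expR x] at [(p - 1) * y] and at [- y], with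
   [y = ln (x / z)]. *)
Lemma young_lt p x z : 1 < p -> 0 <= x -> 0 <= z -> x != z ->
  p * (x * z `^ (p - 1)) < x `^ p + (p - 1) * z `^ p.
Proof.
move=> p1 x0 z0 xz.
have pn : p - 1 != 0 by rewrite subr_eq0 gt_eqF.
have pp : p != 0 by rewrite gt_eqF// (lt_trans ltr01).
have [zE|zn] := eqVneq z 0.
  have xp : 0 < x by rewrite lt_neqAle x0 andbT eq_sym -zE.
  by rewrite zE !powR0// !mulr0 addr0 powR_gt0.
have zp : 0 < z by rewrite lt_neqAle z0 andbT eq_sym.
have Zp : 0 < z `^ p by exact: powR_gt0.
have [xE|xn] := eqVneq x 0.
  by rewrite xE powR0// mul0r mulr0 add0r mulr_gt0// subr_gt0.
have xp : 0 < x by rewrite lt_neqAle x0 andbT eq_sym.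
pose y := ln (x / z).
have xzE : expR y = x / z by rewrite lnK// posrE divr_gt0.
have y0 : y != 0.
  apply/eqP => y0; move: xzE; rewrite y0 expR0 => /esym/eqP.
  by rewrite -subr_eq0 -(mulfV zn) -mulrBl mulf_eq0 subr_eq0 (negbTE xz) invr_eq0 (negbTE zn).
have E : x `^ p = expR (p * y) * z `^ p.
  have {1}-> : x = expR y * z by rewrite xzE divfK.
  by rewrite powRM ?expR_ge0// -expRM [y * p]mulrC.
have F : x * z `^ (p - 1) = expR y * z `^ p.
  by rewrite -(@mulr_powRB1 _ z p)// ?(lt_trans ltr01)// xzE mulrA divfK.
rewrite E F mulrA -mulrDl ltr_pM2r//.
have e1 : 1 + (p - 1) * y < expR ((p - 1) * y).
  by apply: expR_gt1Dx; rewrite mulf_neq0.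
have e2 : 1 - y <= expR (- y) by exact: expR_ge1Dx.
rewrite (_ : p * y = y + (p - 1) * y); last by ring.
rewrite expRD.
have e3 : expR y * expR (- y) = 1 by rewrite expRN mulfV// gt_eqF// expR_gt0.
have ey : 0 < expR y by exact: expR_gt0.
have e4 : (p - 1) * (expR y * expR (- y)) = p - 1 by rewrite e3 mulr1.
have e5 : (p - 1) * (1 - y) <= (p - 1) * expR (- y).
  by rewrite ler_wpM2l// subr_ge0 ltW.
have : 0 < expR y * (expR ((p - 1) * y) + (p - 1) * expR (- y) - p).
  by apply: mulr_gt0 => //; lra.
lra.
Qed.

Lemma young_eq p z : 1 < p -> 0 <= z ->
  p * (z * z `^ (p - 1)) = z `^ p + (p - 1) * z `^ p.
Proof. by move=> p1 z0; rewrite mulr_powRB1// ?(lt_trans ltr01)//; ring. Qed.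

End PowerFunctions.

(** * The generalised sine and its quarter period *)

Section PSine.
Variable (R : realType) (p : R).
Hypothesis p1 : 1 < p.
Local Notation mu := (@lebesgue_measure R).
Implicit Types (x y z s t e c r : R).

Let p0 : 0 < p. Proof. exact: lt_trans p1. Qed.
Let pn0 : p != 0. Proof. by rewrite gt_eqF. Qed.
Let pi0 : 0 < p^-1. Proof. by rewrite invr_gt0. Qed.
Let q0 : 0 < p - 1. Proof. by rewrite subr_gt0. Qed.

(** The generalised cosine as a function of the sine. Absolute value and truncation make it even,
    continuous on the line and zero outside [-1, 1]; the lock keeps the powers from being
    unfolded. *)
Definition slope : R -> R := locked (fun y => (Num.max 0 (1 - `|y| `^ p)) `^ p^-1).

Lemma slope_def : slope = fun y => (Num.max 0 (1 - `|y| `^ p)) `^ p^-1.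
Proof. by rewrite /slope; unlock. Qed.

Lemma slope_continuous : continuous slope.
Proof.
rewrite slope_def; apply: (@powR_comp_continuous _ _ (fun y => Num.max 0 (1 - `|y| `^ p))) => //.
apply/max0_continuous/(@cstB_continuous _ 1 (fun y => `|y| `^ p)).
exact: norm_powR_continuous.
Qed.

Lemma slope_ge0 y : 0 <= slope y. Proof. rewrite slope_def; exact: powR_ge0. Qed.

Lemma norm_powR_le1 y : `|y| <= 1 -> `|y| `^ p <= 1.
Proof.
by move=> y1; rewrite -(@one_powR R p); apply: le_powR => //; exact: ltW.
Qed.

Lemma slopeE y : `|y| <= 1 -> slope y = (1 - `|y| `^ p) `^ p^-1.
Proof. by move=> /norm_powR_le1 H; rewrite slope_def max_r// subr_ge0. Qed.

Lemma slope_powR y : `|y| <= 1 -> slope y `^ p = 1 - `|y| `^ p.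
Proof.
by move=> y1; rewrite slopeE// powRVK// subr_ge0 norm_powR_le1.
Qed.

Lemma slope1 : slope 1 = 0.
Proof. by rewrite slopeE normr1// powR1 subrr powR0// gt_eqF. Qed.

Lemma slope_le1 y : slope y <= 1.
Proof.
rewrite slope_def -[leRHS](@one_powR R p^-1); apply: le_powR; first exact: ltW.
  by rewrite le_max lexx.
by rewrite ge_max ler01/= gerBl powR_ge0.
Qed.

Lemma slope_anti x y : 0 <= x -> x <= y -> slope y <= slope x.
Proof.
move=> x0 xy; rewrite slope_def; apply: le_powR; first exact: ltW.
  by rewrite le_max lexx.
rewrite ge_max !le_max lexx/=; apply/orP; right; rewrite lerB//.
rewrite !ger0_norm ?(le_trans x0)//; apply: le_powR => //; exact: ltW.
Qed.

Lemma slope_gt0 y : `|y| < 1 -> 0 < slope y.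
Proof.
move=> y1; rewrite slopeE ?ltW//; apply: powR_gt0; rewrite subr_gt0.
by rewrite -[ltRHS](@one_powR R p); apply: lt_powR.
Qed.

(* [(slope 1)^-1] is the junk value [0]; only half-open comparisons are used. *)
Definition arcsinp : R -> R :=
  locked (fun y => Iint 0 y (fun s => (slope s)^-1)).

Lemma arcsinp_def y : arcsinp y = Iint 0 y (fun s => (slope s)^-1).
Proof. by rewrite /arcsinp; unlock. Qed.

Lemma le_Iint_o s t (f g : R -> R) : itg s t f -> itg s t g ->
  (forall x, s <= x < t -> f x <= g x) -> Iint s t f <= Iint s t g.
Proof.
move=> fi gi fg.
have sub : `[s, t[%classic `<=` `[s, t]%classic by apply: subset_itvl; rewrite bnd_simp.
have fi' : mu.-integrable `[s, t[ (EFin \o f) by apply: integrableS fi.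
have gi' : mu.-integrable `[s, t[ (EFin \o g) by apply: integrableS gi.
by rewrite /Iint -!Rintegral_itv_bndo_bndc//; exact: le_Rintegral.
Qed.

Lemma slope_inv_measurable (D : set R) : measurable_fun D (fun s => (slope s)^-1).
Proof.
apply: measurable_funTS; rewrite (_ : (fun s => _) = fun s => (slope s) `^ (-1)); last first.
  by apply/funext => s; rewrite powR_inv1// slope_ge0.
apply: (@measurableT_comp _ _ _ _ _ _ (fun x => x `^ (-1))).
  exact: measurable_powR.
exact: continuous_measurable_fun slope_continuous.
Qed.

(* Comparison with the primitive of [(1 - s) `^ (- p^-1)]. *)
Lemma itg_slope_inv_bound r : 0 <= r < 1 ->
  itg 0 r (fun s => (slope s)^-1) /\
  Iint 0 r (fun s => (slope s)^-1) <= p / (p - 1).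
Proof.
move=> /andP[r0 r1].
have q1 : 0 < 1 - p^-1 by rewrite subr_gt0 invf_lt1.
pose B s := - (p / (p - 1)) * `|1 - s| `^ (1 - p^-1).
(* The truncation agrees with [1 - s] on [0, r] and keeps [g] continuous on the whole line. *)
pose m s := Num.max (1 - s) (1 - r).
have mp s : 0 < m s by rewrite lt_max orbC subr_gt0 r1.
pose g s := (m s) `^ (- p^-1).
have cm : continuous m.
  move=> x; apply: (@continuous_max _ _ (fun s : R => 1 - s) (cst (1 - r))).
    by apply: (@cstB_continuous _ 1 id) => ?; exact: id.
  exact: cst_continuous.
have c1 : continuous (fun s : R => 1 - s).
  by apply: (@cstB_continuous _ 1 id) => ?; exact: id.
have cg : continuous g.
  rewrite /g; under eq_fun do rewrite powRN.
  move=> x; apply: cvgV; first by rewrite gt_eqF// powR_gt0.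
  by apply: (powR_comp_continuous pi0 cm) => y; exact: ltW.
have cB : continuous B.
  move=> x; apply: cvgM; first exact: cvg_cst.
  apply: (@continuous_comp _ _ _ (fun s => 1 - s) (fun y => `|y| `^ (1 - p^-1))).
    exact: c1.
  exact: norm_powR_continuous.
have gB : acf 0 r B g.
  apply: derive_acf => // x /andP[x0 xr].
  have x1 : 0 < 1 - x by rewrite subr_gt0 (lt_trans xr).
  have D1 : is_derive x 1 (fun s : R => 1 - s) (-1).
    by rewrite -[-1]add0r; apply: is_deriveB.
  have D2 := @is_derive_powR_comp R (1 - p^-1) (fun s => 1 - s) x _ x1 D1.
  have D3 := is_derive_cmul (- (p / (p - 1))) D2.
  apply: (@near_eq_is_derive _ _ _ (fun s => - (p / (p - 1)) * (1 - s) `^ (1 - p^-1))).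
    near=> y; rewrite /B ger0_norm// subr_ge0 ltW//.
    by near: y; apply: lt_nbhsl; exact: lt_trans r1.
  rewrite [g x](_ : _ = - (p / (p - 1)) *
      ((1 - p^-1) * (1 - x) `^ (1 - p^-1 - 1) * -1)); first exact: D3.
  rewrite /g /m max_l; last by rewrite lerB// ltW.
  rewrite (_ : 1 - p^-1 - 1 = - p^-1); last by ring.
  by field; rewrite pn0 (gt_eqF q0).
(* Since [p > 1], one has [s ^ p <= s] on [0, 1], hence [1 - s <= 1 - s ^ p]. *)
have le_g s : 0 <= s <= r -> (slope s)^-1 <= g s.
  move=> /andP[s0 sr]; have s1 : s < 1 by exact: le_lt_trans r1.
  have ms : 0 < 1 - s by rewrite subr_gt0.
  have E : m s = 1 - s by rewrite /m max_l// lerB.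
  have sp : 0 < slope s by apply: slope_gt0; rewrite ger0_norm.
  rewrite /g E powRN lef_pV2 ?posrE//; last exact: powR_gt0.
  rewrite slopeE ger0_norm//; last exact: ltW.
  apply: le_powR; [exact: ltW|exact: ltW|].
  rewrite lerB//; move: s0; rewrite le_eqVlt => /predU1P[<-|s0]; first by rewrite powR0.
  by apply: ge1r_powR; [rewrite s0 ltW|exact: ltW].
have gi : itg 0 r g by exact: continuous_itg.
have si : itg 0 r (fun s => (slope s)^-1).
  apply: le_itg gi; first exact: slope_inv_measurable.
  by move=> x xr; rewrite ger0_norm ?invr_ge0 ?slope_ge0//; exact: le_g.
split => //; apply: le_trans (le_Iint si gi le_g) _.
have [_ _ <-//] := gB.
rewrite /B subr0 normr1 powR1 mulr1 mulNr opprK -[leRHS]add0r lerD2r oppr_le0.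
by rewrite mulr_ge0 ?powR_ge0//; apply: divr_ge0; exact: ltW.
Unshelve. all: by end_near. Qed.

(** The bound [p / (p - 1)] does not depend on [r], so it survives monotone convergence along
    [0, 1 - 1/(n+1)]. The endpoint 1 is first discarded as a null set. *)
Lemma itg_slope_inv : itg 0 1 (fun s => (slope s)^-1).
Proof.
have ms : measurable_fun (`[0, 1]%classic : set R) (EFin \o (fun s => (slope s)^-1)).
  by apply/measurable_EFinP; exact: slope_inv_measurable.
apply/integrableP; split => //.
under eq_integral do rewrite /= ger0_norm ?invr_ge0 ?slope_ge0//.
rewrite -integral_itv_bndo_bndc; last first.
  by apply/measurable_EFinP; exact: slope_inv_measurable.
pose F (n : nat) : set R := `[0, 1 - n.+1%:R^-1]%classic.
have FE : \bigcup_i F i = `[0, 1[%classic.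
  apply/seteqP; split => [x [n _]|x]; rewrite /= ?/F /= !in_itv/=.
    move=> /andP[-> /le_lt_trans]; apply.
    by rewrite ltrBlDr ltrDl invr_gt0.
  move=> /andP[x0 x1].
  have [n /ltW xn] : exists n : nat, (1 - x)^-1 < n.+1%:R.
    exists (Num.bound (1 - x)^-1); apply: lt_trans (_ : _ < (Num.bound (1 - x)^-1)%:R) _.
      by apply: archi_boundP; rewrite invr_ge0 subr_ge0 ltW.
    by rewrite ltr_nat.
  exists n => //; rewrite /F /= in_itv/= x0/= lerBrDr -lerBrDl.
  by rewrite -[leRHS]invrK lef_pV2 ?posrE ?invr_gt0 ?subr_gt0.
have cv : (\int[mu]_(x in F i) (slope x)^-1%:E @[i --> \oo]
    --> \int[mu]_(x in \bigcup_i F i) (slope x)^-1%:E)%E.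
  apply: ge0_nondecreasing_set_cvg_integral.
  - move=> m n mn; apply/subsetPset; rewrite /F; apply: subset_itvl; rewrite bnd_simp.
    by rewrite lerB// lef_pV2 ?posrE// ler_nat.
  - by move=> i; exact: measurable_itv.
  - by move=> i; apply/measurable_EFinP; exact: slope_inv_measurable.
  - by move=> i x _; rewrite lee_fin invr_ge0 slope_ge0.
rewrite FE in cv; apply: (@le_lt_trans _ _ (p / (p - 1))%:E); last exact: ltry.
apply: cvge_le cv; apply: nearW => n.
have rn : 0 <= (1 - n.+1%:R^-1 : R) < 1.
  by rewrite subr_ge0 invf_le1 ?ler1n//= ltrBlDr ltrDl invr_gt0 ltr0n.
have [si le] := itg_slope_inv_bound rn.
have fn : (\int[mu]_(x in F n) (slope x)^-1%:E)%E \is a fin_num.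
  exact: (integrable_fin_num _ si).
by rewrite -[leLHS](fineK fn) lee_fin.
Qed.

Lemma pi_pE : pi_p p = 2 * arcsinp 1.
Proof.
rewrite /pi_p arcsinp_def /Iint /Rintegral; congr (2 * fine _).
apply: eq_integral => t; rewrite inE/= in_itv/= => /andP[t00 t1].
by rewrite powRN slopeE ger0_norm.
Qed.

(** The integrand is monotone and hence lies between its end values. The form without division
    survives [y = 1], where [slope] vanishes. *)
Lemma arcsinp_diff x y : 0 <= x -> x <= y -> y <= 1 ->
  slope y * (arcsinp y - arcsinp x) <= y - x <= slope x * (arcsinp y - arcsinp x).
Proof.
move=> x0 xy y1; have := itg_slope_inv => si.
rewrite !arcsinp_def (Iint_diff x0 xy y1 si).
have sxy := itgS x0 y1 si.
have i1 c : itg x y (fun=> c) by exact/continuous_itg/cst_continuous.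
apply/andP; split.
  rewrite -IintZ// -[leRHS]mul1r -Iint_cst//; apply: le_Iint => //; first exact: itgZ.
  move=> s /andP[xs sy]; have [->|ss] := eqVneq (slope s) 0.
    by rewrite invr0 mulr0.
  have sp : 0 < slope s by rewrite lt_neqAle slope_ge0 eq_sym ss.
  rewrite ler_pdivrMr// mul1r.
  by apply: slope_anti => //; exact: le_trans xs.
rewrite -IintZ// -[leLHS]mul1r -Iint_cst//; apply: le_Iint_o => //; first exact: itgZ.
move=> s /andP[xs sy].
have ss : 0 < slope s.
  by apply: slope_gt0; rewrite ger0_norm ?(le_trans x0)// (lt_le_trans sy).
apply: (@le_trans _ _ (slope s * (slope s)^-1)).
  by rewrite mulfV// lt0r_neq0.
apply: ler_wpM2r; first by rewrite invr_ge0 slope_ge0.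
exact: slope_anti.
Qed.

(** Comes from [slope <= 1]. It makes [arcsinp] injective and its inverse 1-Lipschitz. *)
Lemma arcsinp_ge x y : 0 <= x -> x <= y -> y <= 1 ->
  y - x <= arcsinp y - arcsinp x.
Proof.
move=> x0 xy y1; have /andP[_ H] := arcsinp_diff x0 xy y1.
have D : 0 <= arcsinp y - arcsinp x.
  rewrite !arcsinp_def (Iint_diff x0 xy y1 itg_slope_inv); apply: Iint_ge0 => s _.
  by rewrite invr_ge0 slope_ge0.
by apply: (le_trans H); rewrite -[leRHS]mul1r ler_wpM2r// slope_le1.
Qed.

Lemma arcsinp0 : arcsinp 0 = 0. Proof. rewrite arcsinp_def; exact: Iintxx. Qed.

Definition halfpi := arcsinp 1.

Lemma halfpi_ge1 : 1 <= halfpi.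
Proof. by have := @arcsinp_ge 0 1; rewrite arcsinp0 !subr0; exact. Qed.

Lemma halfpi_gt0 : 0 < halfpi. Proof. exact: lt_le_trans halfpi_ge1. Qed.

(** The inverse of [arcsinp], with clamping to continue it by [0] on the left and by [1] beyond the
    quarter period. *)
Definition sinp : R -> R := locked (fun z =>
  xget 0 [set x | 0 <= x <= 1 /\ arcsinp x = clamp 0 halfpi z]).

Lemma sinpP z : 0 <= sinp z <= 1 /\ arcsinp (sinp z) = clamp 0 halfpi z.
Proof.
rewrite /sinp; unlock; set A := [set x | _]; suff: A (xget 0 A) by [].
have cT : continuous (fun x => arcsinp (clamp 0 1 x)).
  under eq_fun do rewrite arcsinp_def.
  by have [] := acf_primitive ler01 itg_slope_inv.
have [||x] := @IVT R (fun x => arcsinp (clamp 0 1 x)) 0 1 (clamp 0 halfpi z) ler01.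
- exact: continuous_subspaceT.
- rewrite (@clamp_id _ 0 1 0) ?(@clamp_id _ 0 1 1) ?lexx ?ler01//.
  rewrite arcsinp0 -/halfpi.
  rewrite (min_l (ltW halfpi_gt0)) (max_r (ltW halfpi_gt0)).
  by apply: clamp_itv; exact: ltW halfpi_gt0.
rewrite in_itv/= => x01; rewrite clamp_id// => xz.
by apply: (xgetPex 0); exists x.
Qed.

Lemma sinp_ge0 z : 0 <= sinp z. Proof. by have [/andP[]] := sinpP z. Qed.
Lemma sinp_le1 z : sinp z <= 1. Proof. by have [/andP[]] := sinpP z. Qed.

Lemma sinp_mono z w : z <= w -> sinp z <= sinp w.
Proof.
move=> zw; rewrite leNgt; apply/negP => H.
have := arcsinp_ge (sinp_ge0 w) (ltW H) (sinp_le1 z).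
rewrite (sinpP z).2 (sinpP w).2; have := clamp_lip 0 halfpi zw; lra.
Qed.

Lemma sinp_lip z w : z <= w -> sinp w - sinp z <= w - z.
Proof.
move=> zw; have := arcsinp_ge (sinp_ge0 z) (sinp_mono zw) (sinp_le1 w).
rewrite (sinpP z).2 (sinpP w).2; have := clamp_lip 0 halfpi zw; lra.
Qed.

Lemma sinp_continuous : continuous sinp.
Proof.
move=> x; apply/cvgrPdist_le => e e0; near=> y.
have xyd : `|x - y| <= e by near: y; exact: cvgr_dist_le.
apply: le_trans xyd; case: (leP x y) => xy.
  have := sinp_lip xy; have := sinp_mono xy => A B.
  by rewrite distrC [leRHS]distrC !ger0_norm ?subr_ge0.
have := sinp_lip (ltW xy); have := sinp_mono (ltW xy) => A B.
by rewrite !ger0_norm ?subr_ge0// ltW.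
Unshelve. all: by end_near. Qed.

Lemma sinpK y : 0 <= y <= 1 -> sinp (arcsinp y) = y.
Proof.
move=> /andP[y0 y1]; have [/andP[a b]] := sinpP (arcsinp y).
rewrite clamp_id; last first.
  have := arcsinp_ge y0 y1 (lexx 1); have := arcsinp_ge (lexx 0) y0 y1.
  by rewrite arcsinp0 /halfpi; lra.
move=> E; case: (ltgtP (sinp (arcsinp y)) y) => // H.
  by have := arcsinp_ge a (ltW H) y1; lra.
by have := arcsinp_ge y0 (ltW H) b; lra.
Qed.

Lemma sinp0 : sinp 0 = 0.
Proof. by rewrite -[X in sinp X]arcsinp0 sinpK// lexx ler01. Qed.

Lemma sinp_halfpi : sinp halfpi = 1.
Proof. by rewrite sinpK// ler01 lexx. Qed.

Lemma sinp_gt0 z : 0 < z <= halfpi -> 0 < sinp z.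
Proof.
move=> /andP[z0 zP]; rewrite lt_neqAle sinp_ge0 andbT; apply/eqP => E.
by have := (sinpP z).2; rewrite -E arcsinp0 clamp_id ?zP ?ltW//; lra.
Qed.

Lemma sinp_lt1 z : 0 <= z < halfpi -> sinp z < 1.
Proof.
move=> /andP[z0 zP]; rewrite lt_neqAle sinp_le1 andbT; apply/eqP => E.
by have := (sinpP z).2; rewrite E clamp_id ?z0 ?ltW// -/halfpi; lra.
Qed.

Lemma sinp_norm z : `|sinp z| = sinp z.
Proof. by rewrite ger0_norm ?sinp_ge0. Qed.

Lemma slope_sinp_continuous : continuous (fun z => slope (sinp z)).
Proof.
move=> x; apply: (@continuous_comp _ _ _ sinp slope).
  exact: sinp_continuous.
exact: slope_continuous.
Qed.

(** The increment of [sinp] over [x, y] and the integral of [slope (sinp z)] both lie between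
    [slope (sinp y) * (y - x)] and [slope (sinp x) * (y - x)], which differ by at most [e * (y - x)]
    on a fine mesh. This covers the end [halfpi], where the integrand defining [arcsinp] blows
    up. *)
Lemma sinp_acf : acf 0 halfpi sinp (fun z => slope (sinp z)).
Proof.
have cs := slope_sinp_continuous.
have si s t : itg s t (fun z => slope (sinp z)) by exact: continuous_itg.
split => [|//|a b a0 ab bP]; first exact: sinp_continuous.
pose Psi z := sinp z - Iint a z (fun z => slope (sinp z)).
suff : Psi b = Psi a by rewrite /Psi Iintxx; lra.
apply: (@small_increments R a b Psi id) => // e e0.
have [d d0 H] := @heine_cantor R a b _ e cs e0.
exists d => // x y ax yb xy yx.
rewrite /Psi (_ : _ - _ = (sinp y - sinp x) - Iint x y (fun z => slope (sinp z))); last first.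
  by rewrite -(Iint_diff ax xy yb (si _ _)); lra.
have ix c : itg x y (fun=> c) by exact/continuous_itg/cst_continuous.
have I1 : slope (sinp y) * (y - x) <= Iint x y (fun z => slope (sinp z)).
  rewrite -(Iint_cst _ xy); apply: (le_Iint (ix _) (si _ _)) => z /andP[xz zy].
  by apply: slope_anti; [exact: sinp_ge0|exact: sinp_mono].
have I2 : Iint x y (fun z => slope (sinp z)) <= slope (sinp x) * (y - x).
  rewrite -(Iint_cst _ xy); apply: (le_Iint (si _ _) (ix _)) => z /andP[xz zy].
  by apply: slope_anti; [exact: sinp_ge0|exact: sinp_mono].
have := arcsinp_diff (sinp_ge0 x) (sinp_mono xy) (sinp_le1 y).
rewrite (sinpP x).2 (sinpP y).2 !clamp_id; last 2 first.
- by rewrite (le_trans a0)//= (le_trans xy)// (le_trans yb).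
- by rewrite (le_trans a0)//= ?(le_trans yb)// (le_trans ax).
move=> /andP[I3 I4].
have := H x y; rewrite ax (le_trans xy yb) ger0_norm ?subr_ge0// => /(_ isT yx).
rewrite distrC ger0_norm; last first.
  by rewrite subr_ge0; apply: slope_anti; [exact: sinp_ge0|exact: sinp_mono].
move=> He.
have : (slope (sinp x) - slope (sinp y)) * (y - x) <= e * (y - x).
  by rewrite ler_wpM2r// subr_ge0.
by move: I1 I2 I3 I4; rewrite ler_norml; lra.
Qed.

(** This is the equation of the generalised sine: its flux has derivative [-(p - 1)] times its power
    [p - 1]. It is found by differentiating [(1 - sinp ^ p) ^ ((p - 1) / p)]. *)
Lemma slope_sinp_acf : acf 0 halfpi (fun z => slope (sinp z) `^ (p - 1))
  (fun z => - ((p - 1) * sinp z `^ (p - 1))).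
Proof.
apply: derive_acf.
- apply: powR_comp_continuous => //; first exact: slope_sinp_continuous.
  by move=> x; exact: slope_ge0.
- move=> x; apply: cvgN; apply: cvgM; first exact: cvg_cst.
  apply: (powR_comp_continuous q0); first exact: sinp_continuous.
  exact: sinp_ge0.
move=> x /andP[x0 xP].
have sx1 : sinp x < 1 by apply: sinp_lt1; rewrite xP ltW.
have sx0 : 0 < sinp x by apply: sinp_gt0; rewrite x0 ltW.
have w0 : 0 < 1 - sinp x `^ p.
  by rewrite subr_gt0 -(@one_powR R p); apply: lt_powR => //; exact: ltW.
have D0 : is_derive x 1 sinp (slope (sinp x)).
  by apply: acf_derive sinp_acf _; [exact: slope_sinp_continuous|rewrite x0].
have D1 := is_derive_powR_comp p sx0 D0.
have D2 : is_derive x 1 (fun z => 1 - sinp z `^ p)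
    (0 - p * sinp x `^ (p - 1) * slope (sinp x)).
  by apply: is_deriveB; exact: D1.
have D3 := @is_derive_powR_comp R (p^-1 * (p - 1)) (fun z => 1 - sinp z `^ p) x _ w0 D2.
rewrite (_ : (fun z => slope (sinp z) `^ (p - 1)) =
    (fun z => (1 - sinp z `^ p) `^ (p^-1 * (p - 1)))); last first.
  apply/funext => z /=; rewrite slopeE sinp_norm ?sinp_le1//.
  by rewrite -powRrM.
rewrite [X in is_derive _ _ _ X](_ : _ = p^-1 * (p - 1) *
    (1 - sinp x `^ p) `^ (p^-1 * (p - 1) - 1) *
    (0 - p * sinp x `^ (p - 1) * slope (sinp x))); first exact: D3.
rewrite slopeE sinp_norm ?(ltW sx1)//.
set w := 1 - sinp x `^ p in w0 *; set S := sinp x `^ (p - 1).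
(* The first exponent equals [- p^-1], so the singular factor from the outer power cancels the
   derivative of [sinp]. *)
have E : w `^ (p^-1 * (p - 1) - 1) * w `^ p^-1 = 1.
  rewrite -powRD; last by rewrite (gt_eqF w0) implybT.
  rewrite (_ : _ + _ = 0) ?powRr0//; field.
  exact: pn0.
transitivity (p^-1 * p * (p - 1) *
   (w `^ (p^-1 * (p - 1) - 1) * w `^ p^-1) * - S); last by ring.
by rewrite E mulVf//; ring.
Qed.

Definition fluxint := Iint 0 1 (fun y => slope y `^ (p - 1)).

Lemma slope_flux_continuous : continuous (fun y => slope y `^ (p - 1)).
Proof. by apply: powR_comp_continuous => //; [exact: slope_continuous|exact: slope_ge0]. Qed.

(** Substituting [y = sinp z] turns [fluxint] into the integral of cosine to the [p]. That integral
    is [halfpi] minus the integral of sine to the [p] by the Pythagorean identity, and [p - 1] times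
    the latter by parts; eliminating it gives the relation. *)
Lemma fluxint_halfpi : p * fluxint = (p - 1) * halfpi.
Proof.
have P0 := ltW halfpi_gt0.
have ci s t f : continuous f -> itg s t f by exact: continuous_itg.
pose K y := Iint 0 y (fun y => slope y `^ (p - 1)).
have A : Iint 0 halfpi (fun z => slope (sinp z) `^ (p - 1) * slope (sinp z)) = fluxint.
  rewrite (@acf_comp R 0 halfpi sinp _ (fun y => slope y `^ (p - 1)) K 0 1 P0 sinp_acf).
  - by rewrite sinp_halfpi sinp0 {2}/K Iintxx subr0.
  - exact: slope_flux_continuous.
  - move=> x y x0 xy y1; apply: (Iint_diff x0 xy y1).
    exact/continuous_itg/slope_flux_continuous.
  - by move=> x _; rewrite sinp_ge0 sinp_le1.
have cSp : continuous (fun z => sinp z `^ p).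
  by apply: powR_comp_continuous => //; [exact: sinp_continuous|exact: sinp_ge0].
have B : fluxint = halfpi - Iint 0 halfpi (fun z => sinp z `^ p).
  transitivity (Iint 0 halfpi (fun=> 1) - Iint 0 halfpi (fun z => sinp z `^ p)).
    2: by rewrite Iint_cst// mul1r subr0.
  rewrite -A -IintB.
  - apply: eq_Iint => z _; rewrite mulrC mulr_powRB1 ?slope_ge0//.
    by rewrite slope_powR sinp_norm// sinp_le1.
  - exact/continuous_itg/cst_continuous.
  - exact: continuous_itg.
have := acf_prod P0 sinp_acf slope_sinp_acf.
rewrite sinp_halfpi sinp0 slope1 powR0 ?(gt_eqF q0)// mulr0 mul0r subr0.
rewrite IintD; last 2 first.
- apply: itgM; first exact: sinp_continuous.
  by case: slope_sinp_acf.
- by apply: itgM; [case: slope_sinp_acf|case: sinp_acf].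
rewrite A (_ : Iint 0 halfpi _ = - (p - 1) * Iint 0 halfpi (fun z => sinp z `^ p)).
  by rewrite B; lra.
rewrite -IintZ; last exact: continuous_itg.
apply: eq_Iint => z _; rewrite -(@mulr_powRB1 R (sinp z) p)// ?sinp_ge0//; ring.
Qed.

End PSine.

(** * Affine substitution and concatenation *)

Section Gluing.
Variable R : realType.
Implicit Types (s t x m n : R) (f g u v : R -> R).

Lemma acf_affine s t m n (al : R -> R) f g lo hi : (forall x, al x = m * x + n) ->
  continuous g -> acf lo hi f g -> (forall x, s < x < t -> lo < al x < hi) ->
  acf s t (fun x => f (al x)) (fun x => m * g (al x)).
Proof.
move=> alE cg fg alP; have [cf _ _] := fg.
have cal : continuous al.
  rewrite (_ : al = fun x => m * x + n); last exact/funext.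
  move=> x; apply: cvgD; last exact: cvg_cst.
  by apply: cvgM; [exact: cvg_cst|exact: cvg_id].
apply: derive_acf.
- by move=> x; apply: (@continuous_comp _ _ _ al f); [exact: cal|exact: cf].
- move=> x; apply: cvgM; first exact: cvg_cst.
  by apply: (@continuous_comp _ _ _ al g); [exact: cal|exact: cg].
move=> x xst.
have dal : is_derive x 1 al m.
  rewrite (_ : al = fun x => m * x + n); last exact/funext.
  have d1 : is_derive x 1 (fun x => m * x) (m * 1).
    by apply: is_derive_cmul; exact: is_derive_id.
  have d2 := is_deriveD d1 (is_derive_cst n x 1).
  by rewrite mulr1 addr0 in d2.
rewrite mulrC; exact: (is_derive1_comp (acf_derive cg fg (alP x xst)) dal).
Qed.

Lemma acf_cat s x t u g : s <= x -> x <= t -> itg s t g ->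
  acf s x u g -> acf x t u g -> acf s t u g.
Proof.
move=> sx xt gi [cu g1 u1] [_ g2 u2]; split => // y z sy yz zt.
have [zx|xz] := leP z x; first exact: u1.
have [xy|yx] := leP x y; first exact: u2.
rewrite (@Iint_split _ y x z); [|by rewrite (ltW yx) (ltW xz)|exact: itgS gi].
rewrite -u1 ?(ltW yx)// -u2 ?(ltW xz)//; ring.
Qed.

Lemma eq_acf s t u g h : (forall x, s <= x <= t -> g x = h x) ->
  acf s t u g -> acf s t u h.
Proof.
move=> gh [cu gi ug]; split => //; first exact: eq_itg gi.
move=> x y sx xy yt; rewrite ug//; apply: eq_Iint => z /andP[xz zy].
by rewrite gh// (le_trans sx)//= (le_trans zy).
Qed.

End Gluing.

(** * Symmetry and homogeneity of the fluxes and of the energy density *)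

Section Fluxes.
Variables (R : realType) (p a b : R).
Hypothesis p1 : 1 < p.
Implicit Types (s c : R).

Let p0 : 0 < p. Proof. exact: lt_trans p1. Qed.
Let q0 : 0 < p - 1. Proof. by rewrite subr_gt0. Qed.

Lemma pospart_ge0 s : 0 <= pospart s. Proof. by rewrite /pospart le_max lexx orbT. Qed.
Lemma negpart_ge0 s : 0 <= negpart s. Proof. by rewrite /negpart le_max lexx orbT. Qed.
Lemma pospartN s : pospart (- s) = negpart s. Proof. by []. Qed.
Lemma negpartN s : negpart (- s) = pospart s. Proof. by rewrite /negpart opprK. Qed.
Lemma ge0_pospart s : 0 <= s -> pospart s = s. Proof. exact: max_l. Qed.
Lemma ge0_negpart s : 0 <= s -> negpart s = 0.
Proof. by move=> s0; rewrite /negpart max_r// oppr_le0. Qed.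

Lemma pospartM c s : 0 <= c -> pospart (c * s) = c * pospart s.
Proof. by move=> c0; rewrite /pospart -[in LHS](mulr0 c) maxr_pMr. Qed.
Lemma negpartM c s : 0 <= c -> negpart (c * s) = c * negpart s.
Proof. by move=> c0; rewrite /negpart -mulrN -[in LHS](mulr0 c) maxr_pMr. Qed.

Lemma asym_fluxN s : asym_flux p a b (- s) = - asym_flux p b a s.
Proof. by rewrite /asym_flux pospartN negpartN opprB. Qed.

Lemma asym_fluxM c s : 0 <= c ->
  asym_flux p a b (c * s) = c `^ (p - 1) * asym_flux p a b s.
Proof.
move=> c0; rewrite /asym_flux pospartM// negpartM// !powRM ?pospart_ge0 ?negpart_ge0//.
ring.
Qed.

Lemma plap_fluxN s : plap_flux p (- s) = - plap_flux p s.
Proof. by rewrite /plap_flux normrN mulrN. Qed.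

Lemma ge0_plap_flux s : 0 <= s -> plap_flux p s = s `^ (p - 1).
Proof.
(* At [s = 0] the power with exponent [p - 2] may be a default value, but it is multiplied by
   [0]. *)
rewrite /plap_flux le_eqVlt => /predU1P[<-|s0].
  by rewrite mulr0 powR0// lt0r_neq0.
rewrite gtr0_norm// -[X in _ * X](@powRr1 R)// ?ltW// -powRD; last by rewrite (gt_eqF s0) implybT.
by congr (_ `^ _); ring.
Qed.

Lemma plap_fluxM c s : 0 <= c ->
  plap_flux p (c * s) = c `^ (p - 1) * plap_flux p s.
Proof.
move=> c0; wlog s0 : s / 0 <= s.
  move=> H; have [/H//|s0] := leP 0 s.
  have := H (- s); rewrite oppr_ge0 => /(_ (ltW s0)).
  by rewrite mulrN !plap_fluxN mulrN => /oppr_inj.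
by rewrite !ge0_plap_flux// ?powRM// mulr_ge0.
Qed.

Lemma plap_flux_mul s : plap_flux p s * s = `|s| `^ p.
Proof.
wlog s0 : s / 0 <= s.
  move=> H; have [/H//|s0] := leP 0 s.
  by rewrite -[s]opprK plap_fluxN mulrNN normrN H// oppr_ge0 ltW.
by rewrite ge0_plap_flux// ger0_norm// mulrC mulr_powRB1.
Qed.

Definition energy s := a `^ p * pospart s `^ p + b `^ p * negpart s `^ p.

Lemma energy_ge0 s : 0 <= energy s.
Proof. by rewrite addr_ge0// mulr_ge0 ?powR_ge0. Qed.

Lemma asym_flux_mul s : asym_flux p a b s * s = energy s.
Proof.
rewrite /asym_flux /energy; have [s0|s0] := leP 0 s.
  rewrite ge0_negpart// ge0_pospart// (powR0 (lt0r_neq0 q0)) (powR0 (lt0r_neq0 p0)).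
  by rewrite !mulr0 subr0 addr0 -mulrA [_ * s]mulrC mulr_powRB1.
have Ns : 0 <= - s by rewrite oppr_ge0 ltW.
rewrite -(negpartN s) -(pospartN s) ge0_negpart// ge0_pospart//.
rewrite (powR0 (lt0r_neq0 q0)) (powR0 (lt0r_neq0 p0)) !mulr0 !add0r.
by rewrite -(mulr_powRB1 Ns p0); ring.
Qed.

End Fluxes.

Lemma asym_flux11 (R : realType) (p s : R) : 1 < p ->
  asym_flux p 1 1 s = plap_flux p s.
Proof.
move=> p1; have q0 : p - 1 != 0 by rewrite subr_eq0 gt_eqF.
have P u : 0 <= u -> asym_flux p 1 1 u = plap_flux p u.
  move=> u0; rewrite /asym_flux !one_powR !mul1r ge0_pospart// ge0_negpart//.
  by rewrite (powR0 q0) subr0 ge0_plap_flux.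
have [/P//|s0] := leP 0 s.
by rewrite -[s]opprK asym_fluxN plap_fluxN P// oppr_ge0 ltW.
Qed.

(** * The explicit eigenfunction *)

Section Profile.
Variables (R : realType) (p a b L : R).
Hypotheses (p1 : 1 < p) (a0 : 0 < a) (b0 : 0 < b) (L0 : 0 < L).
Implicit Types (t x : R) (phi h : R -> R).

Let p0 : 0 < p. Proof. exact: lt_trans p1. Qed.
Let q0 : 0 < p - 1. Proof. by rewrite subr_gt0. Qed.
Let ab0 : 0 < a + b. Proof. exact: addr_gt0. Qed.

(** With rates [freq / a] and [freq / b], the rising and falling quarter periods last
    [a * halfpi / freq] and [b * halfpi / freq]; their lengths must add up to [L], and the first one
    is [peak]. *)
Definition freq := (a + b) * halfpi p / L.
Definition peak := t0 a b * L.
Definition eigval := (p - 1) * freq `^ p.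

Lemma freq_gt0 : 0 < freq.
Proof. by rewrite divr_gt0// mulr_gt0// halfpi_gt0. Qed.

Lemma eigvalE : eigval = ((a + b) / 2) `^ p * lam_k p 1 L.
Proof.
have P0 := halfpi_gt0 p1.
rewrite /eigval /lam_k pi_pE// -/(halfpi p) mul1r mulrCA -powRM.
- by congr (_ * _ `^ _); rewrite /freq; field; rewrite lt0r_neq0.
- by apply: divr_ge0 => //; exact: ltW.
- by apply: divr_ge0; [apply: mulr_ge0 => //; exact: ltW|exact: ltW].
Qed.

Lemma peak_itv : 0 < peak < L.
Proof.
rewrite /peak /t0 mulr_gt0 ?divr_gt0//= -[ltRHS]mul1r ltr_pM2r//.
by rewrite ltr_pdivrMr// mul1r ltrDl.
Qed.

Lemma peakL : freq / a * peak = halfpi p.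
Proof. by rewrite /freq /peak /t0; field; rewrite !lt0r_neq0. Qed.

Lemma peakR : freq / b * (L - peak) = halfpi p.
Proof. by rewrite /freq /peak /t0; field; rewrite !lt0r_neq0. Qed.

Let ka0 : 0 < freq / a. Proof. by rewrite divr_gt0// freq_gt0. Qed.
Let kb0 : 0 < freq / b. Proof. by rewrite divr_gt0// freq_gt0. Qed.

(* [sinp] is constant equal to [1] beyond [halfpi], so on either side of the
   peak one of the factors is [1]. *)
Definition profile t := sinp p (freq / a * t) * sinp p (freq / b * (L - t)).

(** Since [slope 1 = 0], only the term of the relevant side survives, and both vanish at the peak;
    this gives a derivative continuous on the whole line. *)
Definition dprofile t := freq / a * slope p (sinp p (freq / a * t))
  - freq / b * slope p (sinp p (freq / b * (L - t))).

Lemma sinp_ge_halfpi z : halfpi p <= z -> sinp p z = 1.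
Proof.
move=> Pz; apply/eqP; rewrite eq_le sinp_le1//=.
by rewrite -(sinp_halfpi p1); exact: sinp_mono.
Qed.

Lemma sinpL t : peak <= t -> sinp p (freq / a * t) = 1.
Proof. by move=> tp; apply: sinp_ge_halfpi; rewrite -peakL ler_pM2l. Qed.

Lemma sinpR t : t <= peak -> sinp p (freq / b * (L - t)) = 1.
Proof. by move=> tp; apply: sinp_ge_halfpi; rewrite -peakR ler_pM2l// lerB. Qed.

Lemma profileL t : t <= peak -> profile t = sinp p (freq / a * t).
Proof. by move=> tp; rewrite /profile sinpR// mulr1. Qed.

Lemma profileR t : peak <= t -> profile t = sinp p (freq / b * (L - t)).
Proof. by move=> tp; rewrite /profile sinpL// mul1r. Qed.

Lemma dprofileL t : t <= peak -> dprofile t = freq / a * slope p (sinp p (freq / a * t)).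
Proof. by move=> tp; rewrite /dprofile sinpR// slope1// mulr0 subr0. Qed.

Lemma dprofileR t : peak <= t ->
  dprofile t = - (freq / b) * slope p (sinp p (freq / b * (L - t))).
Proof. by move=> tp; rewrite /dprofile sinpL// slope1// mulr0 sub0r mulNr. Qed.

Lemma profile_ge0 t : 0 <= profile t.
Proof. by rewrite mulr_ge0// sinp_ge0. Qed.

Lemma profile_gt0 t : 0 < t < L -> 0 < profile t.
Proof.
move=> /andP[t00 tL]; have [tp|/ltW tp] := leP t peak.
  rewrite profileL// sinp_gt0//; rewrite mulr_gt0//=.
  by rewrite -peakL ler_pM2l.
rewrite profileR// sinp_gt0//; rewrite mulr_gt0 ?subr_gt0//=.
by rewrite -peakR ler_pM2l// lerB.
Qed.

Lemma profile_lt1 t : 0 <= t <= L -> t != peak -> profile t < 1.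
Proof.
move=> /andP[t00 tL]; rewrite neq_lt => /orP[tp|tp].
  rewrite profileL ?ltW// sinp_lt1//; rewrite mulr_ge0 ?(ltW ka0)//=.
  by rewrite -peakL ltr_pM2l.
rewrite profileR ?ltW// sinp_lt1//; rewrite mulr_ge0 ?(ltW kb0) ?subr_ge0//=.
by rewrite -peakR ltr_pM2l// ltrD2l ltrN2.
Qed.

Lemma profile_peak : profile peak = 1.
Proof. by rewrite profileL// peakL sinp_halfpi. Qed.

Lemma profile0 : profile 0 = 0.
Proof. by rewrite profileL ?mulr0 ?sinp0//; case/andP: peak_itv => /ltW. Qed.

Lemma profileLL : profile L = 0.
Proof. by rewrite profileR ?subrr ?mulr0 ?sinp0//; case/andP: peak_itv => _ /ltW. Qed.

Let contL (f : R -> R) : continuous f -> continuous (fun t => f (freq / a * t)).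
Proof.
move=> cf x; apply: (@continuous_comp _ _ _ (fun t => freq / a * t) f); last exact: cf.
by apply: cvgM; [exact: cvg_cst|exact: cvg_id].
Qed.

Let contR (f : R -> R) : continuous f -> continuous (fun t => f (freq / b * (L - t))).
Proof.
move=> cf x; apply: (@continuous_comp _ _ _ (fun t => freq / b * (L - t)) f); last exact: cf.
apply: cvgM; first exact: cvg_cst.
by apply: cvgB; [exact: cvg_cst|exact: cvg_id].
Qed.

Lemma profile_continuous : continuous profile.
Proof.
rewrite /profile => x; apply: cvgM.
  exact: (contL (sinp_continuous p1)).
exact: (@contR (sinp p) (sinp_continuous p1) x).
Qed.

Lemma dprofile_continuous : continuous dprofile.
Proof.
rewrite /dprofile => x; apply: cvgB; (apply: cvgM; first exact: cvg_cst).
  exact: (@contL (fun z => slope p (sinp p z)) (slope_sinp_continuous p1) x).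
exact: (@contR (fun z => slope p (sinp p z)) (slope_sinp_continuous p1) x).
Qed.

Let rangeL x : 0 < x < peak -> 0 < freq / a * x < halfpi p.
Proof. by move=> /andP[x0 xp]; rewrite mulr_gt0//= -peakL ltr_pM2l. Qed.

Let rangeR x : peak < x < L -> 0 < freq / b * (L - x) < halfpi p.
Proof.
by move=> /andP[px xL]; rewrite mulr_gt0 ?subr_gt0//= -peakR ltr_pM2l// ltrD2l ltrN2.
Qed.

Let affL x : freq / a * x = freq / a * x + 0. Proof. by rewrite addr0. Qed.
Let affR x : freq / b * (L - x) = - (freq / b) * x + freq / b * L.
Proof. by ring. Qed.

Lemma acf_sinpL : acf 0 peak (fun t => sinp p (freq / a * t))
  (fun t => freq / a * slope p (sinp p (freq / a * t))).
Proof.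
exact: (@acf_affine R 0 peak _ 0 (fun t => freq / a * t) (sinp p)
  (fun z => slope p (sinp p z)) 0 (halfpi p) affL (slope_sinp_continuous p1)
  (sinp_acf p1) rangeL).
Qed.

Lemma acf_sinpR : acf peak L (fun t => sinp p (freq / b * (L - t)))
  (fun t => - (freq / b) * slope p (sinp p (freq / b * (L - t)))).
Proof.
exact: (@acf_affine R peak L _ _ (fun t => freq / b * (L - t)) (sinp p)
  (fun z => slope p (sinp p z)) 0 (halfpi p) affR (slope_sinp_continuous p1)
  (sinp_acf p1) rangeR).
Qed.

Lemma acf_eq s t u v g : continuous v -> (forall x, s <= x <= t -> u x = v x) ->
  acf s t u g -> acf s t v g.
Proof.
move=> cv uv [cu gi ug]; split => // x y sx xy yt.
by rewrite -!uv ?ug// ?sx ?yt ?(le_trans sx xy)// (le_trans xy yt).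
Qed.

Lemma profile_acf : acf 0 L profile dprofile.
Proof.
have /andP[/ltW k0 /ltW kL] := peak_itv.
apply: (acf_cat k0 kL).
- exact/continuous_itg/dprofile_continuous.
- apply: (@eq_acf _ _ _ _ (fun t => freq / a * slope p (sinp p (freq / a * t)))).
    by move=> x /andP[_ xp]; rewrite dprofileL.
  apply: acf_eq acf_sinpL; first exact: profile_continuous.
  by move=> x /andP[_ xp]; rewrite profileL.
- apply: (@eq_acf _ _ _ _ (fun t => - (freq / b) * slope p (sinp p (freq / b * (L - t))))).
    by move=> x /andP[xp _]; rewrite dprofileR.
  apply: acf_eq acf_sinpR; first exact: profile_continuous.
  by move=> x /andP[xp _]; rewrite profileR.
Qed.

Lemma profile_wderiv : wderiv p L profile dprofile.
Proof.
have cd := dprofile_continuous; have di := continuous_itg 0 L cd.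
have [_ _ D] := profile_acf.
have cn : continuous (fun x => `|dprofile x| `^ p).
  apply: powR_comp_continuous => // x.
  by apply: continuous_comp; [exact: cd|exact: norm_continuous].
split => //.
- exact: itg_measurable.
- have /integrableP[_] := continuous_itg 0 L cn.
  congr (_ < _)%E; apply: eq_integral => x _.
  by rewrite /= ger0_norm// powR_ge0.
- by rewrite -(D 0 L (lexx 0) (ltW L0) (lexx L)) profileLL profile0 subr0.
- by move=> t /andP[t00 tL]; rewrite -D// profile0 subr0.
Qed.

Let contS : continuous (fun z => - ((p - 1) * sinp p z `^ (p - 1))).
Proof.
move=> x; apply: cvgN; apply: cvgM; first exact: cvg_cst.
by apply: (powR_comp_continuous q0); [exact: sinp_continuous|exact: sinp_ge0].
Qed.

(** After this cancellation, the factor [freq / c] produced by differentiating the flux leaves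
    [freq ^ p], whichever side [c] belongs to: both halves have the same eigenvalue. *)
Lemma flux_coef c : 0 < c -> c `^ p * (freq / c) `^ (p - 1) = c * freq `^ (p - 1).
Proof.
move=> c0; rewrite -(@mulr_powRB1 R c p) ?(ltW c0)// -mulrA -powRM ?(ltW c0)//.
  by rewrite mulrCA mulfV ?lt0r_neq0// mulr1.
by rewrite divr_ge0 ?(ltW freq_gt0) ?(ltW c0).
Qed.

Lemma asym_flux_profileL t : t <= peak -> asym_flux p a b (dprofile t) =
  a * freq `^ (p - 1) * slope p (sinp p (freq / a * t)) `^ (p - 1).
Proof.
move=> tp; rewrite dprofileL// asym_fluxM ?(ltW ka0)//.
have s0 := slope_ge0 p (sinp p (freq / a * t)).
rewrite /asym_flux ge0_pospart// ge0_negpart// (powR0 (lt0r_neq0 q0)) mulr0 subr0.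
by rewrite mulrA [_ `^ _ * a `^ p]mulrC flux_coef.
Qed.

Lemma asym_flux_profileR t : peak <= t -> asym_flux p a b (dprofile t) =
  - (b * freq `^ (p - 1)) * slope p (sinp p (freq / b * (L - t))) `^ (p - 1).
Proof.
move=> tp; rewrite dprofileR// mulNr asym_fluxN asym_fluxM ?(ltW kb0)//.
have s0 := slope_ge0 p (sinp p (freq / b * (L - t))).
rewrite /asym_flux ge0_pospart// ge0_negpart// (powR0 (lt0r_neq0 q0)) mulr0 subr0.
by rewrite mulrA [_ `^ _ * b `^ p]mulrC flux_coef// mulNr.
Qed.

(** Integration by parts on one side of the peak, [m] being the derivative of [al]. The boundary
    terms vanish because [phi] is zero at the end of the interval and the flux is zero at the peak,
    so the halves can be added without a matching condition. *)
Lemma half_weak s t c m (al : R -> R) phi h : s <= t ->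
  acf s t phi h ->
  acf s t (fun x => slope p (sinp p (al x)) `^ (p - 1))
    (fun x => m * - ((p - 1) * sinp p (al x) `^ (p - 1))) ->
  phi s * slope p (sinp p (al s)) = 0 -> phi t * slope p (sinp p (al t)) = 0 ->
  Iint s t (fun x => c * slope p (sinp p (al x)) `^ (p - 1) * h x) =
  (p - 1) * (c * m) * Iint s t (fun x => sinp p (al x) `^ (p - 1) * phi x).
Proof.
move=> st ph fl e1 e2.
have ends x : phi x * slope p (sinp p (al x)) = 0 ->
    slope p (sinp p (al x)) `^ (p - 1) * phi x = 0.
  move=> /eqP; rewrite mulf_eq0 => /orP[/eqP ->|/eqP ->]; first by rewrite mulr0.
  by rewrite (powR0 (lt0r_neq0 q0)) mul0r.
have := acf_prod st fl ph; rewrite (ends _ e1) (ends _ e2) subrr.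
have [cf fi _] := fl; have [cp hi _] := ph.
rewrite IintD; [|exact: itgM|exact: itgM].
have -> : Iint s t (fun x => c * slope p (sinp p (al x)) `^ (p - 1) * h x) =
    c * Iint s t (fun x => slope p (sinp p (al x)) `^ (p - 1) * h x).
  rewrite -IintZ; last exact: itgM.
  by apply: eq_Iint => x _; rewrite mulrA.
(* Integrability of the right-hand integrand is recovered below from that of the flux derivative,
   which requires division by [m]. *)
have [m0|mn0] := eqVneq m 0.
  move=> H; rewrite m0 !mulr0 mul0r; apply/eqP; rewrite mulf_eq0; apply/orP; right.
  move: H; rewrite (_ : Iint s t (fun x => phi x * _) = 0) ?addr0; first by move/eqP.
  by rewrite m0 (@eq_Iint _ _ _ _ (fun=> 0)) ?Iint_cst ?mul0r// => x _; rewrite mul0r mulr0.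
have wi : itg s t (fun x => sinp p (al x) `^ (p - 1) * phi x).
  have := itgZ (- (m * (p - 1))^-1) (itgM cp fi); apply: eq_itg => x _.
  by field; rewrite mn0 lt0r_neq0.
rewrite (_ : Iint s t (fun x => phi x * _) =
    - (m * (p - 1)) * Iint s t (fun x => sinp p (al x) `^ (p - 1) * phi x)); last first.
  by rewrite -IintZ//; apply: eq_Iint => x _; ring.
move: (Iint _ _ _) (Iint _ _ _) => Y X H.
by rewrite (_ : X = m * (p - 1) * Y); [ring|lra].
Qed.

(** A weak derivative determines [u] on [0, L] only; the clamped primitive is a representative
    continuous on the whole line, as [acf] demands. *)
Lemma wderiv_acf u g : wderiv p L u g ->
  exists v, [/\ acf 0 L v g, v 0 = 0, v L = 0 & forall x, 0 <= x <= L -> u x = v x].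
Proof.
move=> [_ gi _ gL ug]; exists (fun x => Iint 0 (clamp 0 L x) g).
have L00 := ltW L0.
split; first exact: acf_primitive.
- by rewrite clamp_id ?lexx// Iintxx.
- by rewrite clamp_id ?lexx ?L00.
- by move=> x xL; rewrite clamp_id// ug.
Qed.

Lemma freq_powR : freq `^ (p - 1) * freq = freq `^ p.
Proof. by rewrite mulrC mulr_powRB1// ltW// freq_gt0. Qed.

Lemma profile_weak phi h : wderiv p L phi h ->
  Iint 0 L (fun t => asym_flux p a b (dprofile t) * h t)
  = eigval * Iint 0 L (fun t => plap_flux p (profile t) * phi t).
Proof.
move=> /wderiv_acf[v [vh v0 vL pv]].
have /andP[/ltW k0 /ltW kL] := peak_itv.
have -> : Iint 0 L (fun t => plap_flux p (profile t) * phi t) =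
   Iint 0 L (fun t => profile t `^ (p - 1) * v t).
  by apply: eq_Iint => x x0L; rewrite pv// ge0_plap_flux// profile_ge0.
have [cv hi _] := vh.
have cU : continuous (fun t => profile t `^ (p - 1)).
  by apply: (powR_comp_continuous q0); [exact: profile_continuous|exact: profile_ge0].
have cUv : itg 0 L (fun t => profile t `^ (p - 1) * v t).
  exact: (itgM cU (continuous_itg 0 L cv)).
have cF : continuous (fun t => asym_flux p a b (dprofile t)).
  rewrite /asym_flux => x; apply: cvgB; (apply: cvgM; first exact: cvg_cst).
    apply: (@powR_comp_continuous _ _ (fun t => pospart (dprofile t))) => //.
      move=> y; apply: (@continuous_max _ _ dprofile (cst 0)); last exact: cst_continuous.
      exact: dprofile_continuous.
    by move=> y; exact: pospart_ge0.
  apply: (@powR_comp_continuous _ _ (fun t => negpart (dprofile t))) => //.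
    move=> y; apply: (@continuous_max _ _ (fun t => - dprofile t) (cst 0)); last exact: cst_continuous.
    by apply: cvgN; exact: dprofile_continuous.
  by move=> y; exact: negpart_ge0.
have cFh : itg 0 L (fun t => asym_flux p a b (dprofile t) * h t) by exact: (itgM cF).
have k0L : 0 <= peak <= L by rewrite k0.
rewrite (Iint_split k0L cFh) (Iint_split k0L cUv) mulrDr.
congr (_ + _).
- rewrite (@eq_Iint _ 0 peak _ (fun t => a * freq `^ (p - 1) *
      slope p (sinp p (freq / a * t)) `^ (p - 1) * h t)); last first.
    by move=> x /andP[_ xp]; rewrite asym_flux_profileL.
  rewrite (@half_weak 0 peak _ (freq / a) (fun t => freq / a * t) v h k0).
  + rewrite (_ : (p - 1) * (a * freq `^ (p - 1) * (freq / a)) = eigval); last first.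
      by rewrite /eigval -freq_powR; field; rewrite lt0r_neq0.
    by congr (_ * _); apply: eq_Iint => x /andP[_ xp]; rewrite profileL.
  + exact: acfS vh.
  + exact: (@acf_affine R 0 peak _ 0 (fun t => freq / a * t) _ _ 0 (halfpi p) affL
      contS (slope_sinp_acf p1) rangeL).
  + by rewrite v0 mul0r.
  + by rewrite peakL sinp_halfpi// slope1// mulr0.
- rewrite (@eq_Iint _ peak L _ (fun t => - (b * freq `^ (p - 1)) *
      slope p (sinp p (freq / b * (L - t))) `^ (p - 1) * h t)); last first.
    by move=> x /andP[xp _]; rewrite asym_flux_profileR.
  rewrite (@half_weak peak L _ (- (freq / b)) (fun t => freq / b * (L - t)) v h kL).
  + rewrite (_ : (p - 1) * (- (b * freq `^ (p - 1)) * - (freq / b)) = eigval); last first.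
      by rewrite /eigval -freq_powR; field; rewrite lt0r_neq0.
    by congr (_ * _); apply: eq_Iint => x /andP[xp _]; rewrite profileR.
  + exact: acfS vh.
  + exact: (@acf_affine R peak L _ _ (fun t => freq / b * (L - t)) _ _ 0 (halfpi p) affR
      contS (slope_sinp_acf p1) rangeR).
  + by rewrite peakR sinp_halfpi// slope1// mulr0.
  + by rewrite vL mul0r.
Qed.

End Profile.

(** * Young defect, calibration identity and uniqueness for the flow *)

Section Energy.
Variables (R : realType) (p : R).
Hypothesis p1 : 1 < p.
Local Notation mu := (@lebesgue_measure R).
Implicit Types (a b s t c z k L : R) (u v g : R -> R).

Let p0 : 0 < p. Proof. exact: lt_trans p1. Qed.
Let q0 : 0 < p - 1. Proof. by rewrite subr_gt0. Qed.

Lemma energyN a b s : energy p a b (- s) = energy p b a s.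
Proof. by rewrite /energy pospartN negpartN addrC. Qed.

Lemma energyM a b c s : 0 <= c -> energy p a b (c * s) = c `^ p * energy p a b s.
Proof.
move=> c0; rewrite /energy pospartM// negpartM// !powRM ?pospart_ge0 ?negpart_ge0//.
ring.
Qed.

(** The gap in Young's inequality for [a * s] and [z]; [b] is seen only when [s] has the wrong
    sign. *)
Definition defect a b s z :=
  energy p a b s + (p - 1) * z `^ p - p * (a * s * z `^ (p - 1)).

(** For [s >= 0] this is Young's inequality with its equality case. For [s < 0] the cross term helps
    and the energy is positive, so a zero defect also forces the sign of [s]. *)
Lemma defect_spec a b s z : 0 < a -> 0 < b -> 0 <= z ->
  (a * s = z /\ defect a b s z = 0) \/ 0 < defect a b s z.
Proof.
move=> a0 b0 z0; rewrite /defect; have [s0|s0] := leP 0 s.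
  rewrite /energy ge0_negpart// ge0_pospart// (powR0 (lt0r_neq0 p0)) mulr0 addr0.
  have as0 : 0 <= a * s by rewrite mulr_ge0// ltW.
  rewrite -(powRM p (ltW a0) s0).
  have [<-|asz] := eqVneq (a * s) z.
    by left; split => //; rewrite young_eq// subrr.
  by right; rewrite subr_gt0; exact: young_lt.
have Ns : 0 < - s by rewrite oppr_gt0.
right; rewrite -[s]opprK energyN /energy (ge0_negpart (ltW Ns)) (ge0_pospart (ltW Ns)).
rewrite (powR0 (lt0r_neq0 p0)) mulr0 addr0 mulrN mulNr mulrN opprK.
apply: ltr_pwDl; last by rewrite !mulr_ge0 ?powR_ge0 ?(ltW p0) ?(ltW a0) ?(ltW Ns).
by apply: ltr_pwDl; [rewrite mulr_gt0 ?powR_gt0|rewrite mulr_ge0 ?powR_ge0 ?(ltW q0)].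
Qed.

Lemma defect_ge0 a b s z : 0 < a -> 0 < b -> 0 <= z -> 0 <= defect a b s z.
Proof.
by move=> a0 b0 z0; have [[_ ->]|/ltW] := defect_spec s a0 b0 z0.
Qed.

Lemma itg_Lp L g : measurable_fun `[0, L] g ->
  (\int[mu]_(x in `[0%R, L]) (`|g x| `^ p)%:E < +oo)%E ->
  itg 0 L (fun x => `|g x| `^ p).
Proof.
move=> mg gf; apply/integrableP; split.
  apply/measurable_EFinP; apply: (@measurableT_comp _ _ _ _ _ _ (fun x => x `^ p)).
    exact: measurable_powR.
  by apply: measurableT_comp => //; exact: normr_measurable.
move: gf; congr (_ < _)%E; apply: eq_integral => x _.
by rewrite /= (ger0_norm (powR_ge0 _ _)).
Qed.

Lemma itg_energy a b L u g : wderiv p L u g -> itg 0 L (fun t => energy p a b (g t)).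
Proof.
move=> [mg _ gf _ _]; have gi := itg_Lp mg gf.
apply: (@le_itg _ _ _ _ (fun x => (a `^ p + b `^ p) * `|g x| `^ p)); last exact: itgZ.
  have mp (f : R -> R) : measurable_fun `[0, L] f ->
      measurable_fun `[0, L] (fun x => pospart (f x) `^ p).
    move=> mf; apply: (@measurableT_comp _ _ _ _ _ _ (fun x => x `^ p)).
      exact: measurable_powR.
    by apply: measurable_maxr => //; exact: measurable_cst.
  apply: measurable_funD; apply: measurable_funM; (try exact: measurable_cst).
    exact: mp.
  by apply: (mp (fun x => - g x)); exact: measurableT_comp.
move=> x _; rewrite ger0_norm ?energy_ge0// mulrDl lerD//.
  rewrite ler_wpM2l ?powR_ge0//; apply: le_powR; [exact: ltW|exact: pospart_ge0|].
  by rewrite /pospart ge_max normr_ge0 ler_norm.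
rewrite ler_wpM2l ?powR_ge0//; apply: le_powR; [exact: ltW|exact: negpart_ge0|].
by rewrite /negpart ge_max normr_ge0 -normrN ler_norm.
Qed.

(** Based at [-1], because a function normalised to have maximum 1 may a priori be negative
    elsewhere. *)
Definition flux_primitive y := Iint (-1) y (fun y => slope p y `^ (p - 1)).

Lemma flux_primitive_diff x y : -1 <= x -> x <= y -> y <= 1 ->
  flux_primitive y - flux_primitive x = Iint x y (fun y => slope p y `^ (p - 1)).
Proof.
move=> x1 xy y1; apply: (Iint_diff x1 xy y1).
exact/continuous_itg/slope_flux_continuous.
Qed.

(** The cross term of the defect is an exact derivative along [u], so only the end values of [u]
    survive. The sign [c] will be [1] where [u] should rise, and [-1], with [a] and [b] exchanged,
    where it should fall. *)
Lemma calibration a b s t k c u g : s <= t -> 0 <= k -> acf s t u g ->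
  itg s t (fun x => energy p a b (c * g x)) ->
  (forall x, s <= x <= t -> `|u x| <= 1) ->
  itg s t (fun x => defect a b (c * g x) (k * slope p (u x))) /\
  Iint s t (fun x => defect a b (c * g x) (k * slope p (u x))) =
  Iint s t (fun x => energy p a b (c * g x))
  + (p - 1) * k `^ p * ((t - s) - Iint s t (fun x => `|u x| `^ p))
  - p * (a * c * k `^ (p - 1)) * (flux_primitive (u t) - flux_primitive (u s)).
Proof.
move=> st k0 ug ei u1; have [cu gi _] := ug.
have csl : continuous (fun x => slope p (u x) `^ (p - 1)).
  move=> x; apply: (@continuous_comp _ _ _ u (fun y => slope p y `^ (p - 1))).
    exact: cu.
  exact: slope_flux_continuous.
have cup : continuous (fun x => `|u x| `^ p).
  by move=> x; apply: (@continuous_comp _ _ _ u (fun y => `|y| `^ p));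
    [exact: cu|exact: norm_powR_continuous].
have E x : s <= x <= t -> defect a b (c * g x) (k * slope p (u x)) =
    energy p a b (c * g x) + (p - 1) * k `^ p * (1 - `|u x| `^ p)
    - p * (a * c * k `^ (p - 1)) * (slope p (u x) `^ (p - 1) * g x).
  move=> xst; rewrite /defect !powRM ?slope_ge0// slope_powR ?u1//; ring.
have i3 : itg s t (fun x => 1 - `|u x| `^ p).
  by apply: itgB; [exact/continuous_itg/cst_continuous|exact: continuous_itg].
have i1 := itgZ ((p - 1) * k `^ p) i3.
have i2 : itg s t (fun x => p * (a * c * k `^ (p - 1)) *
    (slope p (u x) `^ (p - 1) * g x)).
  exact/itgZ/itgM.
split.
  apply: eq_itg (itgB (itgD ei i1) i2) => x xst; exact/esym/E.
rewrite (eq_Iint E) IintB//; last exact: itgD.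
rewrite IintD// (IintZ _ i3) (IintZ _ (itgM csl gi)) IintB; 
  [|exact/continuous_itg/cst_continuous|exact: continuous_itg].
rewrite Iint_cst// mul1r.
rewrite (@acf_comp _ s t u g (fun y => slope p y `^ (p - 1)) flux_primitive (-1) 1)//.
- exact: slope_flux_continuous.
- exact: flux_primitive_diff.
- by move=> x /u1; rewrite ler_norml.
Qed.

(* [slope] is nonincreasing on nonnegative reals, so the flow of
   [u' = c * slope u] contracts forward in time if [c > 0], backward if [c < 0]. *)
Lemma slope_flow_contract s t c u v : s <= t ->
  acf s t u (fun x => c * slope p (u x)) -> acf s t v (fun x => c * slope p (v x)) ->
  (forall x, s <= x <= t -> 0 <= u x) -> (forall x, s <= x <= t -> 0 <= v x) ->
  c * (u t - v t) ^+ 2 <= c * (u s - v s) ^+ 2.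
Proof.
move=> st au av u0 v0; have aw := acfB au av.
have := acf_prod st aw aw; rewrite -!expr2.
set I := Iint _ _ _ => E.
suff : c * I <= 0 by rewrite E mulrBr subr_le0.
have [cw wi _] := aw.
rewrite -IintZ; last by apply: itgD; exact: itgM.
rewrite -oppr_ge0 -mulN1r -IintZ; last by apply: itgZ; apply: itgD; exact: itgM.
apply: Iint_ge0 => x xst; move: (u0 x xst) (v0 x xst) => ux vx.
rewrite (_ : _ * _ = 2 * c ^+ 2 * - ((u x - v x) * (slope p (u x) - slope p (v x)))); last by ring.
apply: mulr_ge0; first by apply: mulr_ge0 => //; exact: sqr_ge0.
rewrite oppr_ge0.
have [uv|vu] := leP (u x) (v x).
  by rewrite mulr_le0_ge0// ?subr_le0// subr_ge0; exact: slope_anti.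
by rewrite mulr_ge0_le0 ?subr_ge0 ?(ltW vu)// subr_le0; apply: slope_anti => //; exact: ltW.
Qed.

(** Monotonicity replaces a Lipschitz condition and gives uniqueness in one direction only. In the
    other it fails: for [c = 1] the constant [1] and [sinp] agree at [halfpi]. *)
Lemma slope_flow_unique_fwd s t c u v : s <= t -> 0 < c ->
  acf s t u (fun x => c * slope p (u x)) -> acf s t v (fun x => c * slope p (v x)) ->
  (forall x, s <= x <= t -> 0 <= u x) -> (forall x, s <= x <= t -> 0 <= v x) ->
  u s = v s -> u t = v t.
Proof.
move=> st c0 au av u0 v0 E; have := slope_flow_contract st au av u0 v0.
rewrite E subrr expr0n mulr0 pmulr_rle0// => H.
by apply/eqP; rewrite -subr_eq0 -sqrf_eq0 eq_le H sqr_ge0.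
Qed.

Lemma slope_flow_unique_bwd s t c u v : s <= t -> c < 0 ->
  acf s t u (fun x => c * slope p (u x)) -> acf s t v (fun x => c * slope p (v x)) ->
  (forall x, s <= x <= t -> 0 <= u x) -> (forall x, s <= x <= t -> 0 <= v x) ->
  u t = v t -> u s = v s.
Proof.
move=> st c0 au av u0 v0 E; have := slope_flow_contract st au av u0 v0.
rewrite E subrr expr0n mulr0 nmulr_rge0// => H.
by apply/eqP; rewrite -subr_eq0 -sqrf_eq0 eq_le H sqr_ge0.
Qed.

(** A nonnegative defect with zero integral vanishes almost everywhere, which is the equality case
    of Young's inequality; changing the derivative on a null set does not affect the increments of
    [u]. *)
Lemma acf_defect0 a b s t k c u g : 0 < a -> 0 < b -> 0 <= k -> c != 0 ->
  acf s t u g ->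
  itg s t (fun x => defect a b (c * g x) (k * slope p (u x))) ->
  Iint s t (fun x => defect a b (c * g x) (k * slope p (u x))) = 0 ->
  acf s t u (fun x => k / (a * c) * slope p (u x)).
Proof.
move=> a0 b0 k0 c0 [cu gi ug] di D0.
have z0 x : 0 <= k * slope p (u x) by rewrite mulr_ge0// slope_ge0.
have ae0 := Iint_ae0 di (fun x _ => defect_ge0 (c * g x) a0 b0 (z0 x)) D0.
have csl : continuous (fun x => k / (a * c) * slope p (u x)).
  move=> x; apply: cvgM; first exact: cvg_cst.
  by apply: (@continuous_comp _ _ _ u (slope p)); [exact: cu|exact: slope_continuous].
have ae : ae_eq mu `[s, t]%classic g (fun x => k / (a * c) * slope p (u x)).
  apply: filterS ae0 => x /= H xst; have {}H := H xst.
  have [[E _]|] := defect_spec (c * g x) a0 b0 (z0 x); last by rewrite H ltxx.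
  rewrite mulrAC -E; field.
  by rewrite c0 lt0r_neq0.
split => //; first exact: continuous_itg.
move=> x y sx xy yt; rewrite ug//; apply: ae_eq_Iint.
- exact: itgS gi.
- exact: continuous_itg.
- by apply: ae_eq_subset ae; apply: subset_itv; rewrite bnd_simp.
Qed.

End Energy.

(** * The sharp bound for functions with maximum 1 *)

Section LowerBound.
Variables (R : realType) (p a b L : R).
Hypotheses (p1 : 1 < p) (a0 : 0 < a) (b0 : 0 < b) (L0 : 0 < L).
Implicit Types (u v g : R -> R).

Let p0 : 0 < p. Proof. exact: lt_trans p1. Qed.

Local Notation k := (freq p a b L).
Let k0 : 0 < k. Proof. exact: freq_gt0. Qed.

(* The Young defects of both sides of the maximum add up to the energy excess;
   the constant terms cancel precisely because of [fluxint_halfpi]. *)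
Lemma normalized_bound v g ts : acf 0 L v g -> v 0 = 0 -> v L = 0 ->
  itg 0 L (fun t => energy p a b (g t)) ->
  (forall x, 0 <= x <= L -> `|v x| <= 1) -> 0 <= ts <= L -> v ts = 1 ->
  eigval p a b L * Iint 0 L (fun t => `|v t| `^ p)
    <= Iint 0 L (fun t => energy p a b (g t)) /\
  (Iint 0 L (fun t => energy p a b (g t))
    = eigval p a b L * Iint 0 L (fun t => `|v t| `^ p) ->
   forall x, 0 <= x <= L -> v x = profile p a b L x).
Proof.
move=> vg v0 vL ei v1 tsL vts; have /andP[ts0 tsl] := tsL; have [cv gi _] := vg.
have vgl := acfS (lexx 0) tsl vg; have vgr := acfS ts0 (lexx L) vg.
have eil : itg 0 ts (fun x => energy p a b (1 * g x)).
  by apply: eq_itg (itgS (lexx 0) tsl ei) => x _; rewrite mul1r.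
(* Past the maximum the calibration is applied to [-1 * g] with [a] and [b] exchanged, so that
   descent counts as ascent. *)
have eir : itg ts L (fun x => energy p b a (-1 * g x)).
  by apply: eq_itg (itgS ts0 (lexx L) ei) => x _; rewrite mulN1r energyN.
have [dl El] := calibration p1 ts0 (ltW k0) vgl eil
  (fun x h => v1 x (introT andP (conj (proj1 (andP h)) (le_trans (proj2 (andP h)) tsl)))).
have [dr Er] := calibration p1 tsl (ltW k0) vgr eir
  (fun x h => v1 x (introT andP (conj (le_trans ts0 (proj1 (andP h))) (proj2 (andP h))))).
have Kd : flux_primitive p 1 - flux_primitive p 0 = fluxint p.
  by rewrite flux_primitive_diff ?lerN10 ?ler01.
have Kd' : flux_primitive p 0 - flux_primitive p 1 = - fluxint p.
  by rewrite -Kd opprB.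
have cvp : continuous (fun x => `|v x| `^ p).
  by move=> x; apply: (@continuous_comp _ _ _ v (fun y => `|y| `^ p));
    [exact: cv|exact: norm_powR_continuous].
have sum : Iint 0 ts (fun x => defect p a b (1 * g x) (k * slope p (v x)))
    + Iint ts L (fun x => defect p b a (-1 * g x) (k * slope p (v x)))
  = Iint 0 L (fun t => energy p a b (g t))
    - eigval p a b L * Iint 0 L (fun t => `|v t| `^ p).
  rewrite El Er v0 vL vts (Iint_split tsL ei).
  rewrite (Iint_split tsL (continuous_itg 0 L cvp)).
  rewrite (@eq_Iint _ 0 ts (fun x => energy p a b (1 * g x)) (fun x => energy p a b (g x)));
    last by move=> x _; rewrite mul1r.
  rewrite (@eq_Iint _ ts L (fun x => energy p b a (-1 * g x)) (fun x => energy p a b (g x)));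
    last by move=> x _; rewrite mulN1r energyN.
  rewrite Kd Kd' subr0 /eigval.
  (* The balance that determines [freq]. *)
  have C : p * fluxint p * (a + b) * k `^ (p - 1) = (p - 1) * k `^ p * L.
    rewrite fluxint_halfpi// -freq_powR// [in RHS]/freq.
    by field; rewrite lt0r_neq0.
  move: C; move: (Iint _ _ _) (Iint _ _ _) (Iint _ _ _) (Iint _ _ _) => A B C D.
  move: (k `^ p) (k `^ (p - 1)) (fluxint p) => X Y F E.
  transitivity (D + B - (p - 1) * X * (C + A) +
    ((p - 1) * X * L - p * F * (a + b) * Y)); first by ring.
  by rewrite E subrr addr0.
have z0 x : 0 <= k * slope p (v x) by rewrite mulr_ge0 ?slope_ge0 ?ltW.
have Dl0 : 0 <= Iint 0 ts (fun x => defect p a b (1 * g x) (k * slope p (v x))).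
  by apply: Iint_ge0 => x _; exact: defect_ge0.
have Dr0 : 0 <= Iint ts L (fun x => defect p b a (-1 * g x) (k * slope p (v x))).
  by apply: Iint_ge0 => x _; exact: defect_ge0.
split; first by rewrite -subr_ge0 -sum addr_ge0.
move=> Eq; move: sum; rewrite Eq subrr => /eqP; rewrite paddr_eq0//.
move=> /andP[/eqP Dl /eqP Dr].
have al : acf 0 ts v (fun x => k / a * slope p (v x)).
  have := acf_defect0 p1 a0 b0 (ltW k0) (oner_neq0 R) vgl dl Dl.
  by rewrite mulr1.
have ar : acf ts L v (fun x => - (k / b) * slope p (v x)).
  have N1 : -1 != 0 :> R by rewrite oppr_eq0 oner_neq0.
  have := acf_defect0 p1 b0 a0 (ltW k0) N1 vgr dr Dr.
  by rewrite mulrN1 invrN mulrN.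
have ka : 0 < k / a by rewrite divr_gt0.
have kb : 0 < k / b by rewrite divr_gt0.
(* The sign of [v] is not assumed: the flow is monotone and starts from a zero. Nonnegativity is
   then what the uniqueness lemmas require. *)
have vl0 x : 0 <= x <= ts -> 0 <= v x.
  move=> /andP[x0 xt]; have [_ _ /(_ 0 x (lexx 0) x0 xt)] := al.
  rewrite v0 subr0 => ->; apply: Iint_ge0 => y _.
  by rewrite mulr_ge0 ?slope_ge0// ltW.
have vr0 x : ts <= x <= L -> 0 <= v x.
  move=> /andP[tx xL]; have [_ _ /(_ x L tx xL (lexx L))] := ar.
  rewrite vL sub0r => /eqP; rewrite eqr_oppLR => /eqP ->.
  rewrite -mulN1r -IintZ; last first.
    by case: ar => _ /itgS i _; apply: i.
  apply: Iint_ge0 => y _.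
  by rewrite mulN1r mulNr opprK mulr_ge0 ?slope_ge0// ltW.
have sl x : 0 <= x -> x <= ts -> x <= peak a b L -> v x = sinp p (k / a * x).
  move=> x0 xt xp.
  apply: (slope_flow_unique_fwd p1 x0 ka (acfS (lexx 0) xt al)
    (acfS (lexx 0) xp (acf_sinpL p1 a0 b0 L0))).
  - by move=> y /andP[y0 yx]; apply: vl0; rewrite y0 (le_trans yx).
  - by move=> y _; exact: sinp_ge0.
  - by rewrite v0 mulr0 sinp0.
have Nkb : - (k / b) < 0 by rewrite oppr_lt0.
have sr x : x <= L -> ts <= x -> peak a b L <= x -> v x = sinp p (k / b * (L - x)).
  move=> xL tx px.
  apply: (slope_flow_unique_bwd p1 xL Nkb (acfS tx (lexx L) ar)
    (acfS px (lexx L) (acf_sinpR p1 a0 b0 L0))).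
  - by move=> y /andP[xy yL]; apply: vr0; rewrite yL (le_trans tx).
  - by move=> y _; exact: sinp_ge0.
  - by rewrite vL subrr mulr0 sinp0.
have /andP[kp0 kpL] := peak_itv a0 b0 L0.
(* Otherwise [ts] lies strictly on one side of the peak, where [v] coincides with the profile; the
   profile is below 1 there, whereas [v ts = 1]. *)
have tsE : ts = peak a b L.
  apply/eqP; apply: contraT => tsN.
  have := profile_lt1 p1 a0 b0 L0 tsL tsN.
  have [tp|/ltW tp] := leP ts (peak a b L).
    by rewrite profileL// -(sl ts ts0 (lexx _) tp) vts ltxx.
  by rewrite profileR// -(sr ts tsl (lexx _) tp) vts ltxx.
move=> x /andP[x0 xL]; have [xp|/ltW xp] := leP x (peak a b L).
  by rewrite profileL// sl// tsE.
by rewrite profileR// sr// tsE.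
Qed.

End LowerBound.

(** * The bound and its equality case for arbitrary functions *)

Section Rigidity.
Variables (R : realType) (p L : R).
Hypotheses (p1 : 1 < p) (L0 : 0 < L).
Implicit Types (a b c : R) (u v g : R -> R).

Let p0 : 0 < p. Proof. exact: lt_trans p1. Qed.

Lemma eigvalC a b : eigval p a b L = eigval p b a L.
Proof. by rewrite /eigval /freq [a + b]addrC. Qed.

Lemma positive_max_bound a b v g ts : 0 < a -> 0 < b ->
  acf 0 L v g -> v 0 = 0 -> v L = 0 ->
  itg 0 L (fun t => energy p a b (g t)) ->
  (forall x, 0 <= x <= L -> `|v x| <= v ts) -> 0 <= ts <= L -> 0 < v ts ->
  eigval p a b L * Iint 0 L (fun t => `|v t| `^ p)
    <= Iint 0 L (fun t => energy p a b (g t)) /\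
  (Iint 0 L (fun t => energy p a b (g t))
    = eigval p a b L * Iint 0 L (fun t => `|v t| `^ p) ->
   forall x, 0 <= x <= L -> v x = v ts * profile p a b L x).
Proof.
move=> a0 b0 vg v0 vL ei vm tsL M0; pose c := (v ts)^-1.
have c0 : 0 < c by rewrite invr_gt0.
have [cv gi _] := vg.
have cp : 0 < c `^ p by exact: powR_gt0.
have eE x : energy p a b (c * g x) = c `^ p * energy p a b (g x).
  by rewrite energyM// ltW.
have ei' : itg 0 L (fun t => energy p a b (c * g t)).
  by apply: eq_itg (itgZ (c `^ p) ei) => x _; rewrite eE.
have [|||||H1 H2] := @normalized_bound R p a b L p1 a0 b0 L0 _ _ ts (acfZ c vg) _ _ ei'.
- by rewrite v0 mulr0.
- by rewrite vL mulr0.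
- move=> x xL; rewrite normrM (gtr0_norm c0) mulrC ler_pdivrMr// mul1r.
  exact: vm.
- exact: tsL.
- by rewrite mulVf// lt0r_neq0.
have cvp : continuous (fun x => `|v x| `^ p).
  by move=> x; apply: (@continuous_comp _ _ _ v (fun y => `|y| `^ p));
    [exact: cv|exact: norm_powR_continuous].
have I1 : Iint 0 L (fun t => energy p a b (c * g t)) =
    c `^ p * Iint 0 L (fun t => energy p a b (g t)).
  by rewrite -IintZ//; apply: eq_Iint => x _; rewrite eE.
have I2 : Iint 0 L (fun t => `|c * v t| `^ p) = c `^ p * Iint 0 L (fun t => `|v t| `^ p).
  rewrite -IintZ; last exact: continuous_itg.
  by apply: eq_Iint => x _; rewrite normrM powRM// (gtr0_norm c0).
move: H1 H2; rewrite I1 I2 mulrCA ler_pM2l// => H1 H2; split => // E x xL.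
by rewrite -H2 ?E// mulrA mulfV ?mul1r// lt0r_neq0.
Qed.

(** The sign of [u] at a maximum point of its absolute value decides between the two alternatives.
    If it is negative, the positive case is applied to minus [u] with [a] and [b] exchanged, which
    leaves [eigval] unchanged. *)
Lemma energy_bound a b u g : 0 < a -> 0 < b -> wderiv p L u g ->
  eigval p a b L * Lpp p L u <= Iint 0 L (fun t => energy p a b (g t)) /\
  (Iint 0 L (fun t => energy p a b (g t)) = eigval p a b L * Lpp p L u ->
   (exists t, 0 <= t <= L /\ u t != 0) ->
   exists c, 0 < c /\
    ((forall t, 0 <= t <= L -> u t = c * profile p a b L t) \/
     (forall t, 0 <= t <= L -> u t = - (c * profile p b a L t)))).
Proof.
move=> a0 b0 ug; have ei := itg_energy p1 a b ug.
have [v [vg v0 vL uv]] := wderiv_acf L0 ug.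
have -> : Lpp p L u = Iint 0 L (fun t => `|v t| `^ p).
  by apply: eq_Iint => x xL; rewrite uv.
have [cv gi vgE] := vg.
have [|ts] := @EVT_max R (fun x => `|v x|) 0 L (ltW L0).
  apply: continuous_subspaceT => x; apply: continuous_comp; first exact: cv.
  exact: norm_continuous.
rewrite in_itv/= => tsL vm.
have {}vm x : 0 <= x <= L -> `|v x| <= `|v ts| by move=> xL; apply: vm; rewrite in_itv.
have [vts|vts|vts] := ltgtP 0 (v ts).
- have [|H1 H2] := positive_max_bound a0 b0 vg v0 vL ei _ tsL vts.
    by move=> x /vm; rewrite (gtr0_norm vts).
  split => // E _; exists (v ts); split => //; left => t tL.
  by rewrite uv// H2.
- have vg' := acfZ (-1) vg.
  have Nvts : 0 < -1 * v ts by rewrite mulN1r oppr_gt0.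
  have ei' : itg 0 L (fun t => energy p b a (-1 * g t)).
    by apply: eq_itg ei => x _; rewrite mulN1r energyN.
  have [|||H1 H2] := @positive_max_bound b a _ _ ts b0 a0 vg' _ _ ei' _ tsL Nvts.
  + by rewrite v0 mulr0.
  + by rewrite vL mulr0.
  + by move=> x /vm; rewrite !mulN1r normrN (ltr0_norm vts).
  have I1 : Iint 0 L (fun t => energy p b a (-1 * g t)) =
      Iint 0 L (fun t => energy p a b (g t)).
    by apply: eq_Iint => x _; rewrite mulN1r energyN.
  have I2 : Iint 0 L (fun t => `|-1 * v t| `^ p) = Iint 0 L (fun t => `|v t| `^ p).
    by apply: eq_Iint => x _; rewrite mulN1r normrN.
  move: H1 H2; rewrite I1 I2 (eigvalC b a) => H1 H2; split; [exact: H1|move=> E _].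
  exists (-1 * v ts); split; first exact: Nvts.
  by right => t tL; rewrite (uv t tL) -(H2 E t tL) mulN1r opprK.
- have vz x : 0 <= x <= L -> v x = 0.
    by move=> /vm; rewrite -vts normr0 normr_le0 => /eqP.
  split; last first.
    by move=> _ [t [tL]]; rewrite uv// vz// eqxx.
  rewrite (@eq_Iint _ 0 L _ (fun=> 0)); last first.
    by move=> x xL; rewrite vz// normr0 powR0// lt0r_neq0.
  rewrite Iint_cst ?(ltW L0)// mul0r mulr0.
  by apply: Iint_ge0 => x _; exact: energy_ge0.
Qed.

End Rigidity.

(** * Weak solutions, the value of the infimum and identification of [phi_p] *)

Section WeakSolutions.
Variables (R : realType) (p : R).
Hypothesis p1 : 1 < p.
Local Notation mu := (@lebesgue_measure R).
Implicit Types (a b c L lam : R) (u v g phi h : R -> R).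

Let p0 : 0 < p. Proof. exact: lt_trans p1. Qed.
Let q0 : 0 < p - 1. Proof. by rewrite subr_gt0. Qed.

Lemma wderivZ c L u g : 0 < L -> wderiv p L u g ->
  wderiv p L (fun t => c * u t) (fun t => c * g t).
Proof.
move=> L0 [mg gi gf gL ug]; have cgi : itg 0 L (fun t => c * g t) by exact: itgZ.
split.
- exact: itg_measurable cgi.
- exact: cgi.
- have /integrableP[_] := itgZ (`|c| `^ p) (itg_Lp mg gf).
  congr (_ < _)%E; apply: eq_integral => x _.
  by rewrite /= (ger0_norm (mulr_ge0 (powR_ge0 _ _) (powR_ge0 _ _))) normrM powRM.
- by rewrite IintZ// gL mulr0.
- by move=> t /andP[t00 tL]; rewrite ug ?t00// IintZ//; exact: itgS gi.
Qed.

Lemma eq_wderiv L u v g : (forall t, 0 <= t <= L -> u t = v t) ->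
  wderiv p L u g -> wderiv p L v g.
Proof.
by move=> uv [mg gi gf gL ug]; split => // t tL; rewrite -uv// ug.
Qed.

Lemma eq_weak_sol a b L lam u v : (forall t, 0 <= t <= L -> u t = v t) ->
  weak_sol_ab p a b L lam u -> weak_sol_ab p a b L lam v.
Proof.
move=> uv [g [ug H]]; exists g; split; first exact: eq_wderiv ug.
move=> phi h ph; rewrite (H _ _ ph); congr (_ * _).
by apply: eq_Iint => t tL; rewrite uv.
Qed.

(* Constants are moved onto the test function, so that no integrability of the
   flux is needed. *)
Lemma weak_solZ a b L lam c u : 0 < L -> 0 <= c -> weak_sol_ab p a b L lam u ->
  weak_sol_ab p a b L lam (fun t => c * u t).
Proof.
move=> L0 c0 [g [ug H]]; exists (fun t => c * g t); split; first exact: wderivZ.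
move=> phi h ph; have := H _ _ (wderivZ (c `^ (p - 1)) L0 ph) => {}H.
rewrite (@eq_Iint _ 0 L _ (fun t => asym_flux p a b (g t) * (c `^ (p - 1) * h t))).
  rewrite H; congr (_ * _); apply: eq_Iint => t _.
  by rewrite plap_fluxM// mulrCA mulrA.
by move=> t _; rewrite asym_fluxM// mulrCA mulrA.
Qed.

Lemma weak_solN a b L lam u : 0 < L -> weak_sol_ab p b a L lam u ->
  weak_sol_ab p a b L lam (fun t => - u t).
Proof.
move=> L0 [g [ug H]]; exists (fun t => -1 * g t); split.
  by apply: eq_wderiv (wderivZ (-1) L0 ug) => t _; rewrite mulN1r.
move=> phi h ph; have := H _ _ (wderivZ (-1) L0 ph) => {}H.
rewrite (@eq_Iint _ 0 L _ (fun t => asym_flux p b a (g t) * (-1 * h t))).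
  rewrite H; congr (_ * _); apply: eq_Iint => t _.
  by rewrite plap_fluxN mulN1r mulrN mulNr.
by move=> t _; rewrite !mulN1r asym_fluxN mulrN mulNr.
Qed.

Lemma weak_sol_energy a b L lam u g : wderiv p L u g ->
  (forall phi h, wderiv p L phi h ->
      Iint 0 L (fun t => asym_flux p a b (g t) * h t)
      = lam * Iint 0 L (fun t => plap_flux p (u t) * phi t)) ->
  Iint 0 L (fun t => energy p a b (g t)) = lam * Lpp p L u.
Proof.
move=> ug /(_ _ _ ug) H.
rewrite (@eq_Iint _ 0 L _ (fun t => asym_flux p a b (g t) * g t)).
  by rewrite H; congr (_ * _); apply: eq_Iint => t _; rewrite plap_flux_mul.
by move=> t _; rewrite asym_flux_mul.
Qed.

Lemma profile_weak_sol a b L : 0 < a -> 0 < b -> 0 < L ->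
  weak_sol_ab p a b L (eigval p a b L) (profile p a b L).
Proof.
move=> a0 b0 L0; exists (dprofile p a b L); split; first exact: profile_wderiv.
by move=> phi h; exact: profile_weak.
Qed.

Lemma Iint_continuous_gt0 s t x (f : R -> R) : continuous f ->
  (forall y, s <= y <= t -> 0 <= f y) -> s < x <= t -> 0 < f x -> 0 < Iint s t f.
Proof.
move=> cf f0 /andP[sx xt] fx.
have [d d0 H] := @heine_cantor R s t f (f x / 2) cf (divr_gt0 fx (ltr0Sn _ _)).
(* On [y, x] the function stays above [f x / 2]; the maximum keeps this interval inside [s, t]. *)
pose y := Num.max s (x - d / 2).
have yx : y < x by rewrite gt_max sx ltrBlDr ltrDl divr_gt0.
have sy : s <= y by rewrite le_max lexx.
have yd : x - y < d.
  have : x - d / 2 <= y by rewrite le_max lexx orbT.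
  lra.
have fi a b : itg a b f by exact: continuous_itg.
apply: (@lt_le_trans _ _ (f x / 2 * (x - y))).
  by rewrite mulr_gt0 ?subr_gt0// divr_gt0.
rewrite -(Iint_cst _ (ltW yx)).
rewrite (@Iint_split _ s x t)//; last by rewrite (ltW sx).
rewrite (@Iint_split _ s y x)//; last by rewrite sy ltW.
have I1 : 0 <= Iint s y f.
  by apply: Iint_ge0 => z /andP[sz zy]; apply: f0; rewrite sz (le_trans zy)// (le_trans (ltW yx)).
have I2 : 0 <= Iint x t f.
  by apply: Iint_ge0 => z /andP[xz zt]; apply: f0; rewrite zt (le_trans (ltW sx)).
have I3 : Iint y x (fun=> f x / 2) <= Iint y x f.
  apply: le_Iint => //; first exact/continuous_itg/cst_continuous.
  move=> z /andP[yz zx].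
  have zd : `|z - x| < d by rewrite distrC ger0_norm ?subr_ge0//; lra.
  have xst : s <= x <= t by rewrite (ltW sx).
  by have := H x z xst zd; rewrite ler_norml => /andP[+ _]; lra.
lra.
Qed.

Lemma LppZ c L u : continuous u -> 0 <= c -> 
  Lpp p L (fun t => c * u t) = c `^ p * Lpp p L u.
Proof.
move=> cu c0; rewrite /Lpp -IintZ; last first.
  apply: continuous_itg => x; apply: (@continuous_comp _ _ _ u (fun y => `|y| `^ p)).
    exact: cu.
  exact: norm_powR_continuous.
by apply: eq_Iint => x _; rewrite normrM powRM// (ger0_norm c0).
Qed.

Lemma profile_normalization a b L : 0 < a -> 0 < b -> 0 < L ->
  exists2 c, 0 < c & Lpp p L (fun t => c * profile p a b L t) = 1.
Proof.
move=> a0 b0 L0; have cU : continuous (profile p a b L) by exact: profile_continuous.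
have /andP[k0 kL] := peak_itv a0 b0 L0.
have N0 : 0 < Lpp p L (profile p a b L).
  apply: (@Iint_continuous_gt0 _ _ (peak a b L)).
  - move=> x; apply: (@continuous_comp _ _ _ (profile p a b L) (fun y => `|y| `^ p)).
      exact: cU.
    exact: norm_powR_continuous.
  - by move=> y _; exact: powR_ge0.
  - by rewrite k0 ltW.
  - by rewrite profile_peak// normr1 one_powR ltr01.
exists ((Lpp p L (profile p a b L)) `^ (- p^-1)); first exact: powR_gt0.
rewrite LppZ ?powR_ge0// powRN.
rewrite -[X in _ * X](powRVK (ltW N0) (lt0r_neq0 p0)) -powRM ?powR_ge0 ?invr_ge0 ?powR_ge0//.
by rewrite mulVf ?one_powR// lt0r_neq0// powR_gt0.
Qed.

(** The lower bound is attained by the normalised profile: as a weak solution tested against itself,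
    it has energy [eigval] times its norm to the power [p]. *)
Lemma lam_abE a b L : 0 < a -> 0 < b -> 0 < L -> lam_ab p a b L = eigval p a b L.
Proof.
move=> a0 b0 L0; rewrite /lam_ab; set E := [set e | _].
have lb : lbound E (eigval p a b L).
  move=> _ [u [g [ug [uN ->]]]].
  by have [+ _] := energy_bound p1 L0 a0 b0 ug; rewrite uN mulr1.
have mem : E (eigval p a b L).
  have [c c0 N] := profile_normalization a0 b0 L0.
  have [g [ug H]] := weak_solZ L0 (ltW c0) (profile_weak_sol a0 b0 L0).
  exists (fun t => c * profile p a b L t), g; split => //; split => //.
  have := weak_sol_energy ug H; rewrite N mulr1 => <-.
  exact: eq_Iint.
apply/eqP; rewrite eq_le; apply/andP; split.
  by apply: ge_inf => //; exists (eigval p a b L).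
by apply: lb_le_inf => //; exists (eigval p a b L).
Qed.

(** Makes the classical operator the case [a = b = 1], so that the rigidity result also applies to
    [phi_p]. *)
Lemma weak_sol_p_ab L lam u : weak_sol_p p L lam u <-> weak_sol_ab p 1 1 L lam u.
Proof.
have E g h : Iint 0 L (fun t => asym_flux p 1 1 (g t) * h t) =
    Iint 0 L (fun t => plap_flux p (g t) * h t).
  by apply: eq_Iint => t _; rewrite asym_flux11.
split=> -[g [ug H]]; exists g; split => // phi h ph; first by rewrite E (H _ _ ph).
by rewrite -E (H _ _ ph).
Qed.

Lemma eigval11 : eigval p 1 1 1 = lam_k p 1 1.
Proof.
by rewrite eigvalE// (_ : (1 + 1) / 2 = 1) ?one_powR ?mul1r// divff.
Qed.

(** The choice operator in [phi_p] is meaningful only once a candidate exists; the normalised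
    profile for [a = b = 1] is one. *)
Lemma phi_pP : is_phi_p p (phi_p p).
Proof.
apply: (@getPex _ [set f | is_phi_p p f]).
have [c c0 N] := profile_normalization ltr01 ltr01 (@ltr01 R).
have sol := weak_solZ ltr01 (ltW c0) (profile_weak_sol ltr01 ltr01 (@ltr01 R)).
exists (fun t => c * profile p 1 1 1 t); split => //.
- by have [g [ug _]] := sol; exists g.
- by move=> t t01; rewrite mulr_gt0// profile_gt0.
- by apply/weak_sol_p_ab; rewrite -eigval11.
Qed.

(** Whatever function was chosen, it is an equality case of [energy_bound], hence on a half-line
    spanned by a profile; its positivity at [1/2] rules out the negative one. *)
Lemma phi_pE : exists2 c, 0 < c & forall t, 0 <= t <= 1 ->
  phi_p p t = c * profile p 1 1 1 t.
Proof.
have [W pos N /weak_sol_p_ab[g [ug H]]] := phi_pP.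
have := weak_sol_energy ug H; rewrite -eigval11.
have [_ B] := energy_bound p1 (@ltr01 R) ltr01 ltr01 ug.
have h01 : 0 < (2^-1 : R) < 1 by rewrite invr_gt0 ltr0n/= invf_lt1// ltr1n.
have h01' : 0 <= (2^-1 : R) <= 1 by case/andP: h01 => /ltW -> /ltW ->.
have ph := pos _ h01.
move=> /B; case; first by exists 2^-1; split => //; rewrite lt0r_neq0.
move=> c [c0 [E|E]]; first by exists c.
have := ph; rewrite (E _ h01') oppr_gt0 ltNge.
by rewrite mulr_ge0 ?profile_ge0// ltW.
Qed.

End WeakSolutions.

(** * From profiles to [phi_plus] and [phi_minus] *)

Section Eigenfunctions.
Variables (R : realType) (p : R).
Hypothesis p1 : 1 < p.
Implicit Types (a b c L t x : R).

(** The two pieces of [phi_plus] use [phi_p] on either side of [1/2], the peak of the symmetric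
    profile, and rescaling matches the arguments of [sinp]. The factor [C] is independent of [a],
    [b] and [L], so that [phi_plus p a b] and [phi_plus p b a] can be compared. *)
Lemma phi_plusE : exists2 C, 0 < C & forall a b L t, 0 < a -> 0 < b -> 0 < L ->
  0 <= t <= L -> phi_plus p a b (t / L) = C * profile p a b L t.
Proof.
have [C C0 H] := phi_pE p1; exists C => // a b L t a0 b0 L0 /andP[tp tL].
have ab0 : 0 < a + b by exact: addr_gt0.
have pk1 : peak 1 1 1 = 2^-1 :> R by rewrite /peak /t0 mulr1 div1r.
have T0 : 0 < t0 a b by rewrite divr_gt0.
have T1 : 0 < 1 - t0 a b by rewrite subr_gt0 ltr_pdivrMr// mul1r ltrDl.
have tL0 : 0 <= t / L by rewrite divr_ge0// ltW.
have tL1 : t / L <= 1 by rewrite ler_pdivrMr// mul1r.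
have nz : (a != 0) && (b != 0) && (L != 0) && (a + b != 0) by rewrite !lt0r_neq0.
case/andP: nz => /andP[/andP[an bn] Ln] abn.
rewrite /phi_plus; case: ltP => tt.
  have x1 : t / L / (2 * t0 a b) <= 2^-1.
    rewrite -subr_ge0.
    have -> : 2^-1 - t / L / (2 * t0 a b) = (t0 a b - t / L) / (2 * t0 a b).
      by field; rewrite Ln lt0r_neq0.
    by rewrite divr_ge0 ?subr_ge0 ?(ltW tt)// mulr_ge0// ltW.
  rewrite H; last first.
    apply/andP; split; first by apply: divr_ge0 => //; rewrite mulr_ge0// ltW.
    by apply: le_trans x1 _; rewrite invf_le1// ler1n.
  have tk : t <= peak a b L by rewrite /peak -ler_pdivrMr// ltW.
  congr (_ * _); rewrite (profileL p1 a0 b0 L0 tk).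
  rewrite (profileL p1 ltr01 ltr01 ltr01) ?pk1//.
  by congr (sinp p _); rewrite /freq /t0; field; rewrite an Ln abn.
have x1 : 2^-1 <= (t / L + 1 - 2 * t0 a b) / (2 * (1 - t0 a b)).
  rewrite -subr_ge0.
  have -> : (t / L + 1 - 2 * t0 a b) / (2 * (1 - t0 a b)) - 2^-1 =
      (t / L - t0 a b) / (2 * (1 - t0 a b)).
    by field; rewrite Ln lt0r_neq0.
  by rewrite divr_ge0 ?subr_ge0// mulr_ge0// ltW.
rewrite H; last first.
  apply/andP; split; first by apply: le_trans x1; rewrite invr_ge0.
  rewrite ler_pdivrMr; [lra|exact: mulr_gt0].
have tk : peak a b L <= t by rewrite /peak -ler_pdivlMr.
congr (_ * _); rewrite (profileR p1 a0 b0 L0 tk).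
rewrite (profileR p1 ltr01 ltr01 ltr01) ?pk1//.
congr (sinp p _); rewrite /freq /t0; field.
by rewrite bn Ln abn.
Qed.

Lemma phi_minusE a b t : 0 < a -> 0 < b -> phi_minus p a b t = - phi_plus p b a t.
Proof.
move=> a0 b0; have abn : a + b != 0 by rewrite lt0r_neq0// addr_gt0.
have T : t0 b a = 1 - t0 a b by rewrite /t0 addrC; field.
rewrite /phi_minus /phi_plus T; case: ltP => // _.
by congr (- phi_p p (_ / _)); ring.
Qed.

(** A difference quotient is a mean of the continuous derivative, so its error is bounded by the
    oscillation of [g] near [x], at interior points and endpoints alike. *)
Lemma acf_C1 (f u g : R -> R) : continuous g -> acf 0 1 u g ->
  (forall t, 0 <= t <= 1 -> f t = u t) -> C1_01 f.
Proof.
move=> cg [cu gi ug] fu; exists g; split; first exact: continuous_subspaceT.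
have quot a b c e : 0 <= a -> a < b -> b <= 1 ->
    (forall w, a <= w <= b -> `|g w - c| <= e) ->
    `|c - (u b - u a) / (b - a)| <= e.
  move=> a0 ab b1 ge; have ba : 0 < b - a by rewrite subr_gt0.
  have := @Iint_freeze R a b c e g (fun=> 1) cg
    (continuous_itg _ _ (@cst_continuous _ _ _)) ge.
  rewrite normr1 Iint_cst ?(ltW ab)// !mul1r (@eq_Iint _ a b _ g); last first.
    by move=> w _; rewrite mulr1.
  rewrite -(ug a b a0 (ltW ab) b1) => B.
  have -> : c - (u b - u a) / (b - a) = (c * (b - a) - (u b - u a)) / (b - a).
    by rewrite [RHS]mulrBl mulfK// lt0r_neq0.
  by rewrite normrM normfV (gtr0_norm ba) ler_pdivrMr// distrC.
move=> x x01; apply/cvgrPdist_le => e e0.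
have [d d0 H] := @heine_cantor R 0 1 g e cg e0.
rewrite near_withinE; near=> y => -[y01 yx].
have xyd : `|x - y| < d by near: y; exact: cvgr_dist_lt.
have /andP[x0 x1] := x01; have /andP[y0 y1] := y01.
rewrite !fu//; move: yx; rewrite neq_lt => /orP[yx|xy].
  (* For [y < x] both differences change sign, which restores the ordered case of [quot]. *)
  rewrite -(opprB (u x)) -(opprB x) invrN mulrNN; apply: quot => // w /andP[yw wx].
  apply: H => //; rewrite distrC ger0_norm ?subr_ge0//; move: xyd.
  rewrite gtr0_norm ?subr_gt0//; lra.
apply: quot => // w /andP[xw wy].
apply: H => //; rewrite ger0_norm ?subr_ge0//; move: xyd.
rewrite ltr0_norm ?subr_lt0//; lra.
Unshelve. all: by end_near. Qed.

End Eigenfunctions.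

Theorem theorem1 (R : realType) (p a b L : R) :
  1 < p -> 0 < a -> 0 < b -> 0 < L ->
  [/\ lam_ab p a b L = ((a + b) / 2) `^ p * lam_k p 1 L,
      (forall u : R -> R, eigenfn_ab p a b L u <->
         exists c : R, 0 < c /\
           ((forall t, 0 <= t <= L -> u t = c * phi_plus p a b (t / L)) \/
            (forall t, 0 <= t <= L -> u t = c * phi_minus p a b (t / L)))),
      [/\ C1_01 (phi_plus p a b), C1_01 (phi_minus p a b),
          (forall t, 0 < t < 1 -> 0 < phi_plus p a b t) &
          (forall t, 0 < t < 1 -> phi_minus p a b t < 0)] &
      ((forall t, 0 <= t <= 1 -> phi_plus p a b t = - phi_minus p a b t)
         <-> a = b)].
Proof.
move=> p1 a0 b0 L0; have [C C0 HC] := phi_plusE p1.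
have lamE := lam_abE p1 a0 b0 L0.
have HC1 x y t : 0 < x -> 0 < y -> 0 <= t <= 1 ->
    phi_plus p x y t = C * profile p x y 1 t.
  by move=> x0 y0 t01; rewrite -(HC x y 1 t x0 y0 ltr01 t01) divr1.
have oo t : 0 < t < 1 -> 0 <= t <= (1 : R).
  by move=> /andP[/ltW -> /ltW ->].
have pos x y t : 0 < x -> 0 < y -> 0 < t < 1 -> 0 < phi_plus p x y t.
  move=> x0 y0 t01; rewrite (HC1 x y t x0 y0 (oo t t01)).
  by rewrite mulr_gt0// (profile_gt0 p1 x0 y0 ltr01 t01).
have mE t : phi_minus p a b t = - phi_plus p b a t by exact: phi_minusE.
split; first by rewrite lamE eigvalE.
- move=> u; rewrite /eigenfn_ab lamE; split.
    move=> [_ [nz [g [ug H]]]].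
    have [_ B] := energy_bound p1 L0 a0 b0 ug.
    have [c [c0 E]] := B (weak_sol_energy p1 ug H) nz.
    (* [C] is the ratio between [phi_plus] and the profile. *)
    exists (c / C); split; first exact: divr_gt0.
    case: E => E; [left|right] => t tL; rewrite (E t tL).
      by rewrite (HC a b L t a0 b0 L0 tL) [RHS]mulrA divfK// lt0r_neq0.
    rewrite mE (HC b a L t b0 a0 L0 tL) [RHS]mulrN; congr (- _).
    by rewrite [RHS]mulrA divfK// lt0r_neq0.
  move=> [c [c0 E]].
  have cC : 0 < c * C by exact: mulr_gt0.
  have sol : weak_sol_ab p a b L (eigval p a b L) u.
    case: E => E.
      apply: eq_weak_sol (weak_solZ p1 L0 (ltW cC) (profile_weak_sol p1 a0 b0 L0)).
      by move=> t tL; rewrite (E t tL) (HC a b L t a0 b0 L0 tL) [RHS]mulrA.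
    (* The negative eigenfunction is minus a profile for the exchanged pair, whose eigenvalue is the
       same. *)
    rewrite (eigvalC p L a b).
    have S := weak_solN L0
      (weak_solZ p1 L0 (ltW cC) (profile_weak_sol p1 b0 a0 L0)).
    apply: (eq_weak_sol _ S).
    by move=> t tL; rewrite (E t tL) mE (HC b a L t b0 a0 L0 tL) [RHS]mulrN [in RHS]mulrA.
  split; first by have [g [ug _]] := sol; exists g.
  split => //.
  case: E => E.
    have /andP[/ltW k0 /ltW kL] := peak_itv a0 b0 L0.
    have kl : 0 <= peak a b L <= L by rewrite k0.
    exists (peak a b L); split => //.
    rewrite (E _ kl) (HC a b L _ a0 b0 L0 kl) (profile_peak p1 a0 b0 L0) mulr1.
    exact: lt0r_neq0.
  have /andP[/ltW k0 /ltW kL] := peak_itv b0 a0 L0.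
  have kl : 0 <= peak b a L <= L by rewrite k0.
  exists (peak b a L); split => //.
  rewrite (E _ kl) mE (HC b a L _ b0 a0 L0 kl) (profile_peak p1 b0 a0 L0) mulr1.
  by rewrite mulrN oppr_eq0 lt0r_neq0.
- split.
  + apply: (@acf_C1 R _ _ _ _ (acfZ C (profile_acf p1 a0 b0 ltr01))).
      move=> x; apply: cvgM; first exact: cvg_cst.
      exact: dprofile_continuous.
    by move=> t t01; exact: HC1.
  + apply: (@acf_C1 R _ _ _ _ (acfZ (- C) (profile_acf p1 b0 a0 ltr01))).
      move=> x; apply: cvgM; first exact: cvg_cst.
      exact: dprofile_continuous.
    by move=> t t01; rewrite mE (HC1 b a t b0 a0 t01) mulNr.
  + by move=> t t01; exact: pos.
  + by move=> t t01; rewrite mE oppr_lt0; exact: pos.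
- split=> [H|ab]; last by move=> t _; rewrite mE opprK ab.
  (* Equality is evaluated at the peak for [a], [b]: the profile for [b], [a] must reach 1 there,
     which it does only at its own peak, and equal peaks force [a = b]. *)
  have /andP[/ltW k0 /ltW kL] := peak_itv a0 b0 (@ltr01 R).
  have kl : 0 <= peak a b 1 <= 1 by rewrite k0.
  have := H _ kl; rewrite mE opprK (HC1 a b _ a0 b0 kl) (HC1 b a _ b0 a0 kl).
  rewrite (profile_peak p1 a0 b0 ltr01) => /(mulfI (lt0r_neq0 C0)) E.
  have [pE|/(profile_lt1 p1 b0 a0 ltr01 kl)] := eqVneq (peak a b 1) (peak b a 1).
    move: pE; rewrite /peak /t0 !mulr1 [b + a]addrC => /(congr1 ( *%R^~ (a + b))).
    by rewrite !divfK// lt0r_neq0// addr_gt0.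
  by rewrite -E ltxx.
Qed.
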